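(* Let $\Lambda=\mathbb{Z}[t,t^{-1}]$ and let $M$ be a finitely generated $\Lambda$-module. Assume that (up to multiplication by a unit $\pm t^i$) its order is $\Delta(M)=c_0+\cdots+c_dt^d$ with $c_0,\dots,c_d\in\mathbb{Z}$, $c_0c_d\neq 0$ and $\gcd(c_0,\ldots,c_d)=1$. Let $\bar M=M/zM$, where $zM$ is the maximal finite $\Lambda$-submodule of $M$. Then there exist injective homomorphisms $f,g:\mathbb{Z}^d\to\mathbb{Z}^d$ such that: (1) $\bar M$ is isomorphic, as a $\Lambda$-module, to the infinite amalgamated free product $$\cdots\oplus_{\mathbb{Z}^d}\mathbb{Z}^d\oplus_{\mathbb{Z}^d}\mathbb{Z}^d\oplus_{\mathbb{Z}^d}\cdots$$ with identical injective amalgamations given by $f$ and $g$ (on which $t$ acts by the shift automorphism $\mu$); (2) $\Delta(M)=\det(tg-f)$, up to multiplication by a unit $\pm t^i$ of $\Lambda$; (3) $|c_0|=|\mathbb{Z}^d:f(\mathbb{Z}^d)|$ and $|c_d|=|\mathbb{Z}^d:g(\mathbb{Z}^d)|$.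
   Context: $\Lambda=\mathbb{Z}[t,t^{-1}]$ is the ring of integer Laurent polynomials, a Noetherian unique factorization domain with units $\pm t^i$. Order: a finitely generated $\Lambda$-module $M$ is the cokernel of a homomorphism $\Lambda^r\xrightarrow{A}\Lambda^s$, where $A$ is an $r\times s$ presentation matrix over $\Lambda$ (columns correspond to generators, rows to relations), and one may assume $r\ge s$. The order $\Delta(M)$ is the greatest common divisor of the $s\times s$ minors of $A$. It is well defined up to multiplication by units $\pm t^i$. Infinite amalgamated free product (in the category of abelian groups): given abelian groups $U,B$ and homomorphisms $f,g:U\to B$, let $B_j$ ($j\in\mathbb{Z}$) be copies of $B$. The group $\cdots\oplus_U B\oplus_U B\oplus_U\cdots$ is the quotient of $\bigoplus_{j\in\mathbb{Z}}B_j$ by the subgroup generated by all elements $f(u)_j-g(u)_{j+1}$ with $u\in U$, $j\in\mathbb{Z}$, where $b_j$ denotes the copy of $b\in B$ in $B_j$. The automorphism $\mu$ induced by $b_j\mapsto b_{j+1}$ (shift one place to the right) makes this group a $\Lambda$-module with $t$ acting as $\mu$; thus $t\,g(u)=f(u)$ holds for the copies of $f(u),g(u)$ in a fixed factor. Here $U=B=\mathbb{Z}^d$. $|\mathbb{Z}^d:H|$ denotes the index of the subgroup $H$ in $\mathbb{Z}^d$. In $\det(tg-f)$, $f$ and $g$ are regarded as $d\times d$ integer matrices. *)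

(* Defs.v *)
From HB Require Import structures.
From mathcomp Require Import all_boot all_order all_algebra.
From mathcomp Require Import fraction generic_quotient ring_quotient.
From mathcomp Require Import boolp finmap.
From mathcomp.multinomials Require Import monalg.

Set Implicit Arguments.
Unset Strict Implicit.
Unset Printing Implicit Defensive.

Import GRing.Theory.

Local Open Scope ring_scope.
Local Open Scope quotient_scope.

(** * The ring Z[t, t^-1]
    It is realised inside the field of fractions of Z[X], as the subring of
    the fractions of the form p / X^n. *)

Local Notation "p %:F" := (@FracField.tofrac {poly int} p).

Definition laurent_pred : {pred {fraction {poly int}}} :=
  fun x => `[< exists (n : nat) (p : {poly int}), x = p%:F / ('X^n)%:F >].

Lemma tofracX_neq0 n : ('X^n : {poly int})%:F != 0.
Proof. by rewrite tofrac_eq0 expf_neq0 // polyX_eq0. Qed.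

Lemma laurent_predP x :
  reflect (exists n (p : {poly int}), x * ('X^n)%:F = p%:F) (x \in laurent_pred).
Proof.
apply: (iffP (asboolP _)) => -[n [p e]]; exists n, p.
  by rewrite e mulfVK ?tofracX_neq0.
by rewrite -e mulfK ?tofracX_neq0.
Qed.

Lemma laurent_subring : subring_closed laurent_pred.
Proof.
split.
- by apply/laurent_predP; exists 0, 1; rewrite expr0 mulr1.
- move=> x y /laurent_predP[n [p ep]] /laurent_predP[m [q eq]].
  apply/laurent_predP; exists (n + m)%N, (p * 'X^m - q * 'X^n).
  by rewrite exprD rmorphB !rmorphM /= -ep -eq mulrBl; congr (_ - _);
    rewrite ?mulrA // mulrAC.
- move=> x y /laurent_predP[n [p ep]] /laurent_predP[m [q eq]].
  apply/laurent_predP; exists (n + m)%N, (p * q).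
  by rewrite exprD !rmorphM /= -ep -eq mulrACA.
Qed.

HB.instance Definition _ :=
  GRing.isSubringClosed.Build {fraction {poly int}} laurent_pred laurent_subring.

Record laurent : predArgType :=
  Laurent { laurent_val : {fraction {poly int}}; _ : laurent_val \in laurent_pred }.

HB.instance Definition _ := [isSub for laurent_val].
HB.instance Definition _ := [Choice of laurent by <:].
HB.instance Definition _ := [SubChoice_isSubComNzRing of laurent by <:].

Definition laurent_unit : {pred laurent} :=
  fun x => (val x != 0) && ((val x)^-1 \in laurent_pred).
Definition laurent_inv (x : laurent) : laurent :=
  if laurent_unit x then insubd x (val x)^-1 else x.

Lemma laurent_mulVx : {in laurent_unit, left_inverse 1 laurent_inv *%R}.
Proof.
move=> x ux; apply: val_inj; rewrite rmorphM rmorph1 /= /laurent_inv.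
move: ux; rewrite unfold_in => /andP[x0 xV].
by rewrite /laurent_unit x0 xV /= insubdK // mulVf.
Qed.

Lemma laurent_unitP (x y : laurent) : y * x = 1 -> laurent_unit x.
Proof.
move=> /(congr1 val); rewrite rmorphM rmorph1 /= => e.
have x0 : val x != 0.
  by apply: contra_eq_neq e => ->; rewrite mulr0 eq_sym oner_neq0.
rewrite /laurent_unit x0 /= -[_^-1]mul1r -e mulfK //.
exact: valP.
Qed.

Lemma laurent_inv_out : {in [predC laurent_unit], laurent_inv =1 id}.
Proof.
move=> x nx; rewrite /laurent_inv; case: ifP => // ux.
by case/negP: nx.
Qed.

HB.instance Definition _ := GRing.ComNzRing_hasMulInverse.Build laurent
  laurent_mulVx laurent_unitP laurent_inv_out.

Lemma laurent_mulf_eq0 : GRing.integral_domain_axiom laurent.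
Proof.
move=> x y /(congr1 val); rewrite rmorphM rmorph0 /= => /eqP.
by rewrite mulf_eq0 -!(inj_eq val_inj) rmorph0.
Qed.

HB.instance Definition _ :=
  GRing.ComUnitRing_isIntegral.Build laurent laurent_mulf_eq0.

Lemma laurent_polyP (p : {poly int}) : p%:F \in laurent_pred.
Proof. by apply/laurent_predP; exists 0, p; rewrite expr0 mulr1. Qed.

Definition laurent_of_poly (p : {poly int}) : laurent := Laurent (laurent_polyP p).

Definition laurent_t : laurent := laurent_of_poly 'X.

Definition eq_up_to_unit (a b : laurent) : Prop :=
  exists (s : bool) (i : int), a = (-1) ^+ s * laurent_t ^ i * b.

(** * The module of an automorphism
    An automorphism mu of an abelian group V makes V a Z[t, t^-1]-module on
    which t acts as mu: p / t^n acts as mu^-n o p(mu). *)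

Record group_aut (V : zmodType) := GroupAut {
  aut_fun :> {additive V -> V};
  aut_inv : V -> V;
  aut_funK : cancel aut_fun aut_inv;
  aut_invK : cancel aut_inv aut_fun
}.

Definition aut_module (V : zmodType) (mu : group_aut V) : Type := V.

HB.instance Definition _ V mu := GRing.Zmodule.on (@aut_module V mu).

Section AutModule.
Variables (V : zmodType) (mu : group_aut V).
Implicit Types (p q : {poly int}) (u v : V) (a b : laurent).

Definition poly_act p v : V := \sum_(i < size p) iter i mu v *~ p`_i.

Lemma poly_actE n p v :
  (size p <= n)%N -> poly_act p v = \sum_(i < n) iter i mu v *~ p`_i.
Proof.
move=> le_pn; rewrite /poly_act (big_ord_widen n (fun i => iter i mu v *~ p`_i)) //.
rewrite big_mkcond; apply: eq_bigr => i _.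
by case: ltnP => // h; rewrite nth_default // mulr0z.
Qed.

Lemma iter_autD n u v : iter n mu (u + v) = iter n mu u + iter n mu v.
Proof. by elim: n => //= n ->; rewrite raddfD. Qed.

Lemma iter_aut_inj n : injective (iter n mu).
Proof. by elim: n => //= n IHn u v /(can_inj (@aut_funK _ mu))/IHn. Qed.

Lemma iter_autK n v : iter n mu (iter n (aut_inv mu) v) = v.
Proof. by elim: n v => //= n IHn v; rewrite -iterS iterSr aut_invK. Qed.

Lemma poly_actDr p : {morph poly_act p : u v / u + v}.
Proof.
move=> u v; rewrite /poly_act -big_split; apply: eq_bigr => i _ /=.
by rewrite iter_autD mulrzDl.
Qed.

Lemma poly_actDl p q v : poly_act (p + q) v = poly_act p v + poly_act q v.
Proof.
rewrite !(@poly_actE (maxn (size p) (size q))) ?leq_maxl ?leq_maxr ?size_polyD //.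
by rewrite -big_split; apply: eq_bigr => i _; rewrite coefD mulrzDr.
Qed.

Lemma poly_act_aut p v : poly_act p (mu v) = mu (poly_act p v).
Proof.
by rewrite /poly_act raddf_sum; apply: eq_bigr => i _; rewrite -iterSr raddfMz.
Qed.

Lemma poly_actMX p v : poly_act (p * 'X) v = mu (poly_act p v).
Proof.
rewrite (@poly_actE (size p).+1); last first.
  have [->|p0] := eqVneq p 0; first by rewrite mul0r size_poly0.
  by rewrite size_mulX.
rewrite big_ord_recl coefMX /= mulr0z add0r /poly_act raddf_sum.
by apply: eq_bigr => i _; rewrite coefMX /= raddfMz.
Qed.

Lemma poly_actC (c : int) v : poly_act c%:P v = v *~ c.
Proof. by rewrite (@poly_actE 1) ?size_polyC_leq1 // big_ord1 coefC. Qed.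

Lemma poly_actCM (c : int) q v : poly_act (c%:P * q) v = poly_act q v *~ c.
Proof.
rewrite (@poly_actE (size q)); last by rewrite mul_polyC size_scale_leq.
rewrite /poly_act mulrz_suml; apply: eq_bigr => i _.
by rewrite coefCM mulrC mulrzA.
Qed.

Lemma poly_actM p q v : poly_act (p * q) v = poly_act p (poly_act q v).
Proof.
elim/poly_ind: p v => [|p c IHp] v.
  by rewrite mul0r /poly_act size_poly0 !big_ord0.
rewrite mulrDl -mulrA (mulrC 'X) mulrA !poly_actDl !poly_actMX IHp.
by rewrite poly_actCM poly_actC.
Qed.

Lemma poly_actXn n v : poly_act 'X^n v = iter n mu v.
Proof.
elim: n => [|n IHn]; first by rewrite expr0 poly_actC.
by rewrite exprSr poly_actMX IHn.
Qed.

Lemma laurent_numP a :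
  {np : nat * {poly int} | val a * ('X^(np.1))%:F = (np.2)%:F}.
Proof.
apply: cid; case/laurent_predP: (valP a) => n [p e].
by exists (n, p).
Qed.

Definition laurent_act a v : aut_module mu :=
  let: (n, p) := sval (laurent_numP a) in iter n (aut_inv mu) (poly_act p v).

Lemma laurent_actE a n p v : val a * ('X^n)%:F = p%:F ->
  iter n mu (laurent_act a v) = poly_act p v.
Proof.
rewrite /laurent_act; case: (laurent_numP a) => -[m q] /= eq ep.
apply: (@iter_aut_inj m); rewrite -iterD addnC iterD iter_autK.
rewrite -!poly_actXn -!poly_actM.
suff -> : 'X^n * q = 'X^m * p by [].
apply/eqP; rewrite -(@tofrac_eq {poly int}) !rmorphM /= -eq -ep; apply/eqP.
by rewrite mulrCA [RHS]mulrCA [X in _ * X]mulrC.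
Qed.

Lemma laurent_actA a b v :
  laurent_act a (laurent_act b v) = laurent_act (a * b) v.
Proof.
case: (laurent_numP a) (laurent_numP b) => -[n p] /= ep [[m q] /= eq].
apply: (@iter_aut_inj (m + n)); rewrite iterD (laurent_actE _ ep).
rewrite (@laurent_actE _ _ (p * q)); last first.
  by rewrite addnC exprD !rmorphM /= -ep -eq mulrACA.
rewrite -poly_actXn -poly_actM mulrC !poly_actM poly_actXn.
by rewrite (laurent_actE _ eq).
Qed.

Lemma laurent_act1 : left_id 1 laurent_act.
Proof.
move=> v; have := @laurent_actE 1 0 1 v; rewrite poly_actC; apply.
by rewrite expr0 rmorph1 mul1r.
Qed.

Lemma laurent_actDr : right_distributive laurent_act +%R.
Proof.
move=> a u v; case: (laurent_numP a) => -[n p] /= ep.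
apply: (@iter_aut_inj n).
by rewrite iter_autD !(laurent_actE _ ep) poly_actDr.
Qed.

Lemma laurent_actDl v : {morph laurent_act^~ v : a b / a + b}.
Proof.
move=> a b; case: (laurent_numP a) (laurent_numP b) => -[n p] /= ep [[m q] /= eq].
apply: (@iter_aut_inj (m + n)); rewrite iter_autD.
rewrite (@laurent_actE _ _ (p * 'X^m + q * 'X^n)); last first.
  rewrite addnC exprD !rmorphD !rmorphM /= -ep -eq mulrDl; congr (_ + _).
    by rewrite mulrA.
  by rewrite mulrAC mulrA.
rewrite poly_actDl ![_ * 'X^_]mulrC !poly_actM !poly_actXn.
by rewrite -(laurent_actE _ ep) -(laurent_actE _ eq) -!iterD addnC.
Qed.

HB.instance Definition _ := GRing.Zmodule_isLmodule.Build laurent (aut_module mu)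
  laurent_actA laurent_act1 laurent_actDr laurent_actDl.

Lemma aut_module_tE (v : aut_module mu) : laurent_t *: v = mu v.
Proof.
have -> : mu v = poly_act 'X v by rewrite -['X]expr1 poly_actXn.
by apply: (@laurent_actE laurent_t 0); rewrite expr0 rmorph1 mulr1.
Qed.

End AutModule.

(** * Quotients *)

Local Notation "{ 'quot' I }" := (@Quotient.quot _ I).

Section QuotientModule.
Variables (R : pzRingType) (M : lmodType R) (N : submodClosed M).

(* Over a ring, closure under scaling gives closure under opposites, which is
   what the quotient of abelian groups asks for. *)
Definition submod_mem : {pred M} := fun x => x \in N.

Lemma submod_mem_zmod : zmod_closed submod_mem.
Proof.
split=> [|x y]; first by have := rpred0 N.
move=> Nx Ny; suff : x - y \in N by [].
by rewrite -scaleN1r; apply: rpredD => //; apply: rpredZ.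
Qed.

HB.instance Definition _ := GRing.isZmodClosed.Build M submod_mem submod_mem_zmod.

Definition quot_module : Type := {quot submod_mem}.

HB.instance Definition _ := GRing.Zmodule.on quot_module.

Definition quot_pi (u : M) : quot_module := \pi u.

Lemma quot_pi_is_additive : zmod_morphism quot_pi.
Proof. exact: raddfB (\pi_{quot submod_mem}). Qed.

HB.instance Definition _ := GRing.isZmodMorphism.Build M quot_module quot_pi
  quot_pi_is_additive.

Lemma quot_pi_surj (x : quot_module) : exists u, x = quot_pi u.
Proof. by exists (repr x); rewrite /quot_pi reprK. Qed.

Lemma quot_piP u v : quot_pi u = quot_pi v <-> u - v \in N.
Proof.
have -> : (u - v \in N) = (u - v \in submod_mem) by [].
by rewrite Quotient.idealrBE; split => /eqP.
Qed.

Definition quot_scale (a : R) (x : quot_module) : quot_module :=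
  quot_pi (a *: repr x).

Lemma quot_scale_pi a (u : M) : quot_scale a (quot_pi u) = quot_pi (a *: u).
Proof.
apply/quot_piP; rewrite -scalerBr; apply: rpredZ.
by apply/quot_piP; rewrite /quot_pi reprK.
Qed.

Lemma quot_scaleA a b x : quot_scale a (quot_scale b x) = quot_scale (a * b) x.
Proof. by have [u ->] := quot_pi_surj x; rewrite !quot_scale_pi scalerA. Qed.

Lemma quot_scale1 : left_id 1 quot_scale.
Proof. by move=> x; have [u ->] := quot_pi_surj x; rewrite quot_scale_pi scale1r. Qed.

Lemma quot_scaleDr : right_distributive quot_scale +%R.
Proof.
move=> a x y; have [[u ->] [v ->]] := (quot_pi_surj x, quot_pi_surj y).
by rewrite -raddfD !quot_scale_pi scalerDr raddfD.
Qed.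

Lemma quot_scaleDl x : {morph quot_scale^~ x : a b / a + b}.
Proof.
move=> a b; have [u ->] := quot_pi_surj x.
by rewrite !quot_scale_pi scalerDl raddfD.
Qed.

HB.instance Definition _ := GRing.Zmodule_isLmodule.Build R quot_module
  quot_scaleA quot_scale1 quot_scaleDr quot_scaleDl.

Lemma quot_pi_is_scalable : scalable quot_pi.
Proof. by move=> a u; rewrite -quot_scale_pi. Qed.

HB.instance Definition _ := GRing.isScalable.Build R M quot_module *:%R quot_pi
  quot_pi_is_scalable.

End QuotientModule.

Section GeneratedSubgroup.
Variables (V : zmodType) (S : V -> Prop).

Definition subgroup_gen : {pred V} :=
  fun x => `[< forall H : zmodClosed V, (forall s, S s -> s \in H) -> x \in H >].

Lemma subgroup_gen_zmod : zmod_closed subgroup_gen.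
Proof.
split=> [|x y /asboolP Sx /asboolP Sy]; apply/asboolP => H SH; first exact: rpred0.
by rewrite rpredB ?Sx ?Sy.
Qed.

HB.instance Definition _ := GRing.isZmodClosed.Build V subgroup_gen subgroup_gen_zmod.

Lemma subgroup_gen_sub s : S s -> s \in subgroup_gen.
Proof. by move=> Ss; apply/asboolP => H; apply. Qed.

End GeneratedSubgroup.

Lemma subgroup_gen_map (V : zmodType) (S : V -> Prop) (h : {additive V -> V}) :
  (forall s, S s -> S (h s)) ->
  forall x, x \in subgroup_gen S -> h x \in subgroup_gen S.
Proof.
move=> hS x /asboolP Sx.
pose K : {pred V} := fun y => h y \in subgroup_gen S.
have Kz : zmod_closed K.
  split=> [|y z Ky Kz].
    by suff : h 0 \in subgroup_gen S by []; rewrite raddf0 rpred0.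
  suff : h (y - z) \in subgroup_gen S by [].
  by rewrite raddfB; exact: rpredB.
pose K' : zmodClosed V := HB.pack K (GRing.isZmodClosed.Build V K Kz).
by apply: (Sx K') => s /hS/subgroup_gen_sub.
Qed.

(** * The infinite amalgamated free product *)

Section Shift.
Variable B : zmodType.

(* {malg B[int]} is the direct sum of copies of B indexed by int, and
   << b *g j >> is the copy of b in the j-th factor. *)
Definition malg_shift (k : int) (x : {malg B[int]}) : {malg B[int]} :=
  \sum_(j <- msupp x) << x@_j *g j + k >>.

Lemma malg_shiftE k x j : (malg_shift k x)@_j = x@_(j - k).
Proof.
rewrite [in RHS](monalgE x) /malg_shift !raddf_sum; apply: eq_bigr => i _ /=.
by rewrite !mcoeffU [in RHS]eq_sym subr_eq eq_sym.
Qed.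

Lemma malg_shift_is_additive k : zmod_morphism (malg_shift k).
Proof. by move=> x y; apply/malgP => j; rewrite !(malg_shiftE, mcoeffB). Qed.

HB.instance Definition _ k := GRing.isZmodMorphism.Build _ _ (malg_shift k)
  (malg_shift_is_additive k).

Lemma malg_shiftU k j b : malg_shift k << b *g j >> = << b *g j + k >>.
Proof.
apply/malgP => i; rewrite malg_shiftE !mcoeffU.
by rewrite -(inj_eq (addIr k) j) addrNK.
Qed.

Lemma malg_shiftK k l x : k + l = 0 -> malg_shift k (malg_shift l x) = x.
Proof.
move=> kl; apply/malgP => j; rewrite !malg_shiftE.
by rewrite -addrA -opprD kl subr0.
Qed.

End Shift.

Section Amalgam.
Variables (U B : zmodType) (f g : {additive U -> B}).

Definition amalgam_rel (x : {malg B[int]}) : Prop :=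
  exists (u : U) (j : int), x = << f u *g j >> - << g u *g j + 1 >>.

Definition amalgam_group : zmodType := {quot subgroup_gen amalgam_rel}.

Definition amalgam_pi (x : {malg B[int]}) : amalgam_group := \pi x.

Lemma amalgam_pi_is_additive : zmod_morphism amalgam_pi.
Proof. exact: raddfB (\pi_{quot subgroup_gen amalgam_rel}). Qed.

HB.instance Definition _ := GRing.isZmodMorphism.Build _ _ amalgam_pi
  amalgam_pi_is_additive.

Lemma amalgam_pi_surj (x : amalgam_group) : exists y, x = amalgam_pi y.
Proof. by exists (repr x); rewrite /amalgam_pi reprK. Qed.

Lemma amalgam_piP x y :
  amalgam_pi x = amalgam_pi y <-> x - y \in subgroup_gen amalgam_rel.
Proof. by rewrite Quotient.idealrBE; split => /eqP. Qed.

(* mu is amalgam_shift 1. *)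
Definition amalgam_shift (k : int) (x : amalgam_group) : amalgam_group :=
  amalgam_pi (malg_shift k (repr x)).

Lemma amalgam_shift_pi k x :
  amalgam_shift k (amalgam_pi x) = amalgam_pi (malg_shift k x).
Proof.
apply/amalgam_piP; rewrite -raddfB; apply: subgroup_gen_map; last first.
  by apply/amalgam_piP; rewrite /amalgam_pi reprK.
move=> _ [u [j ->]]; exists u, (j + k).
by rewrite raddfB /= !malg_shiftU addrAC.
Qed.

Lemma amalgam_shift_is_additive k : zmod_morphism (amalgam_shift k).
Proof.
move=> x y; have [[u ->] [v ->]] := (amalgam_pi_surj x, amalgam_pi_surj y).
by rewrite -raddfB !amalgam_shift_pi !raddfB.
Qed.

HB.instance Definition _ k := GRing.isZmodMorphism.Build _ _ (amalgam_shift k)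
  (amalgam_shift_is_additive k).

Lemma amalgam_shiftK k l : k + l = 0 -> cancel (amalgam_shift l) (amalgam_shift k).
Proof.
move=> kl x; have [u ->] := amalgam_pi_surj x.
by rewrite !amalgam_shift_pi malg_shiftK.
Qed.

Definition amalgam_mu : group_aut amalgam_group :=
  GroupAut (amalgam_shiftK (addNr 1)) (amalgam_shiftK (subrr 1)).

Definition amalgam : lmodType laurent := aut_module amalgam_mu.

Lemma amalgam_tE (u : U) (j : int) :
  laurent_t *: (amalgam_pi << g u *g j >> : amalgam) = amalgam_pi << f u *g j >>.
Proof.
rewrite aut_module_tE /= amalgam_shift_pi malg_shiftU; apply/esym/amalgam_piP.
by apply: subgroup_gen_sub; exists u, j.
Qed.

End Amalgam.

(** * Modules over Z[t, t^-1] *)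

Definition finitely_generated (R : pzRingType) (M : lmodType R) : Prop :=
  exists (n : nat) (e : 'I_n -> M),
    forall x : M, exists a : 'I_n -> R, x = \sum_i a i *: e i.

Definition lmod_iso (R : pzRingType) (M N : lmodType R) : Prop :=
  exists h : {linear M -> N}, bijective h.

(* M is the cokernel of R^r -> R^s, v |-> v A. *)
Definition presents (R : comPzRingType) (r s : nat) (A : 'M[R]_(r, s))
    (M : lmodType R) : Prop :=
  exists h : {linear 'rV[R]_s -> M},
    (forall x, exists u, h u = x) /\
    (forall u, h u = 0 <-> exists v : 'rV[R]_r, u = v *m A).

Definition divides (R : pzRingType) (a b : R) : Prop := exists c, b = c * a.

(* The s x s minors are indexed by the s-element subsets of the rows, listed
   in increasing order. *)
Definition is_minor (R : comPzRingType) (r s : nat) (A : 'M[R]_(r, s)) (m : R) :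
    Prop :=
  exists h : 'I_s -> 'I_r,
    {homo h : i j / (i < j)%N} /\ m = \det (rowsub h A).

Definition is_gcd (R : pzRingType) (S : R -> Prop) (D : R) : Prop :=
  (forall m, S m -> divides D m) /\
  (forall e, (forall m, S m -> divides e m) -> divides e D).

Definition is_order (M : lmodType laurent) (D : laurent) : Prop :=
  exists (r s : nat) (A : 'M[laurent]_(r, s)),
    [/\ (s <= r)%N, presents A M & is_gcd (is_minor A) D].

Definition finite_submodule (R : pzRingType) (M : lmodType R)
    (N : submodClosed M) : Prop :=
  exists l : seq M, {subset N <= l}.

Definition maximal_finite_submodule (R : pzRingType) (M : lmodType R)
    (N : submodClosed M) : Prop :=
  finite_submodule N /\
  forall N' : submodClosed M, finite_submodule N' -> {subset N' <= N}.

(* The cosets of H are enumerated without repetition by representatives. *)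
Definition has_index (V : zmodType) (H : V -> Prop) (n : nat) : Prop :=
  exists e : 'I_n -> V, forall v : V, exists! i : 'I_n, H (v - e i).

(* Main.v *)
Require Import Defs.
From HB Require Import structures.
From mathcomp Require Import all_boot all_order all_algebra.
From mathcomp Require Import perm fraction qpoly boolp finmap.
From mathcomp.multinomials Require Import monalg.

Set Implicit Arguments.
Unset Strict Implicit.
Unset Printing Implicit Defensive.

Import GRing.Theory.

Local Open Scope ring_scope.

(** Write N for M/zM, and let t act on N.

    The structure of N comes from two facts.  First, N has no Z-torsion.  For a
    prime p, if every maximal minor of a presentation matrix A of M were
    divisible by p, then so would be their gcd, against primitivity of the
    order; as minors annihilate M, some polynomial that is nonzero modulo p
    annihilates M ([annihilator_mod_prime]).  An element of N killed by p then
    spans a quotient of F_p[t, 1/t]/(q) with q nonzero, hence a finite submodule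
    ([cyclic_submodule_finite]), and its preimage in M is finite because zM is;
    by maximality it lies in zM ([quot_torsion_free]).  Second, N is finitely
    presented, since zM is finite ([presents_quot_finite]).

    Let x_1, ..., x_s be the generators of such a presentation, take n at least
    as large as the degrees of its relations and of an annihilating polynomial,
    and put B = span of the t^i x_j with i <= n, U = span of those with i < n.
    Both are finitely generated torsion-free groups, hence free
    ([torsion_free_span_free]).  The inclusion g : U -> B and multiplication by
    t, f : U -> B, are injective.  The leading coefficient of the annihilating
    polynomial carries B into U, so the ranks agree and f, g become square
    integer matrices.  The relations of N all follow from t g(u) = f(u): this
    identity makes t^i x_j computable inside B for i <= n, and the defining
    relations of N, being of degree at most n, become identities in B.  So N is
    presented by t g - f ([pencil_presentation]).  The amalgam of f and g is
    presented by the same matrix ([amalgam_presented]), which gives the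
    isomorphism.

    For the order, the tool is a form of the invariance of the Fitting ideal
    ([divides_det_relations]): if E divides all determinants of s relations
    among the s generators of a presentation, it divides the determinant of any
    square system of relations among any generating family.  Applied to N it
    gives det(tg - f) | D; applied to M, with generators of N lifted to M and
    relations multiplied by an exponent of zM, it gives D | k det(tg - f) for
    some integer k > 0.  Both being polynomials with nonzero constant
    term, their degrees coincide, so the quotient D / det(tg - f) is an integer
    up to a power of t, and primitivity makes it a sign ([primitive_quotient]).
    Comparing constant and leading coefficients yields |c_0| = |det f| and
    |c_d| = |det g|, which are indices by the Smith normal form
    ([has_index_det]). *)

(** * Minors and relations *)

Section Divides.
Variable R : comPzRingType.
Implicit Types a b c : R.

Lemma divides_mull a b c : divides a b -> divides a (c * b).
Proof. by case=> e ->; exists (c * e); rewrite mulrA. Qed.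

Lemma divides_sum (I : Type) (r : seq I) (P : pred I) (F : I -> R) a :
  (forall i, P i -> divides a (F i)) -> divides a (\sum_(i <- r | P i) F i).
Proof.
move=> aF; apply: (big_ind (divides a)) => //; first by exists 0; rewrite mul0r.
by move=> _ _ [u ->] [v ->]; exists (u + v); rewrite mulrDl.
Qed.

End Divides.

Section Minors.
Variable R : comNzRingType.

(** The Cauchy-Binet expansion, over all functions rather than over
    increasing ones: the extra terms vanish or repeat up to sign. *)
Lemma det_mulmx_rect m n (W : 'M[R]_(m, n)) (A : 'M[R]_(n, m)) :
  \det (W *m A)
    = \sum_(f : {ffun 'I_m -> 'I_n}) (\prod_i W i (f i)) * \det (rowsub f A).
Proof.
rewrite {1}/determinant.
under eq_bigr => s _ do under eq_bigr => i _ do rewrite mxE.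
under eq_bigr => s _ do rewrite bigA_distr_bigA mulr_sumr.
rewrite exchange_big; apply: eq_bigr => f _; rewrite /determinant mulr_sumr.
apply: eq_bigr => s _; rewrite mulrCA big_split /=; congr (_ * (_ * _)).
by apply: eq_bigr => i _; rewrite mxE.
Qed.

(** Selecting rows by an arbitrary function gives 0 if a row is repeated, and
    otherwise permutes the rows of a minor. *)
Lemma rowsub_minor r s (A : 'M[R]_(r, s)) (f : 'I_s -> 'I_r) E :
  (forall m, is_minor A m -> divides E m) -> divides E (\det (rowsub f A)).
Proof.
move=> EA; have [/injectiveP f_inj|/injectivePn[i [j ij fij]]] := boolP (injectiveb f);
  last first.
  exists 0; rewrite mul0r; apply: (determinant_alternate ij) => k.
  by rewrite !mxE fij.
pose S := [set f i | i in 'I_s].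
have cS : #|S| = s by rewrite card_imset // card_ord.
pose h (i : 'I_s) : 'I_r := Order.enum_val (cast_ord (esym cS) i).
have fS i : f i \in S by apply: imset_f.
pose g (i : 'I_s) : 'I_s := cast_ord cS (Order.enum_rank_in (fS i) (f i)).
have hg i : h (g i) = f i by rewrite /h /g cast_ordK Order.EnumVal.enum_rankK_in.
have g_inj : injective g by move=> i j gij; apply: f_inj; rewrite -!hg gij.
have -> : rowsub f A = row_perm (perm g_inj) (rowsub h A).
  by apply/matrixP=> i j; rewrite !mxE permE hg.
rewrite row_permE det_mulmx; apply/divides_mull/EA; exists h; split=> // i j ij.
rewrite ltnNge -[(_ <= _)%N]/((h j <= h i)%O) Order.EnumVal.le_enum_val.
by rewrite -ltnNge.
exact: Order.TotalTheory.le_total.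
Qed.

(** Appending free columns to relations that factor through A: expansion along
    the extra columns, one at a time, leaves determinants of the form W A. *)
Lemma divides_det_row_mx r s e (A : 'M[R]_(r, s)) E
    (W1 : 'M[R]_(e + s, r)) (W2 : 'M[R]_(e + s, e)) :
  (forall W : 'M[R]_(s, r), divides E (\det (W *m A))) ->
  divides E (\det (row_mx W2 (W1 *m A))).
Proof.
move=> EA; elim: e W1 W2 => [|e IHe] W1 W2.
  by rewrite row_thin_mx; apply: EA.
rewrite (expand_det_col _ ord0); apply: divides_sum => i _.
apply: divides_mull; rewrite /cofactor; apply: divides_mull.
have -> : ord0 = lshift s (ord0 : 'I_e.+1) by apply: val_inj.
rewrite col'Kl row'_row_mx.
have -> : row' i (W1 *m A) = row' i W1 *m A.
  by apply/matrixP=> j k; rewrite !mxE; apply: eq_bigr => l _; rewrite mxE.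
exact: IHe.
Qed.

(** Invariance of the Fitting ideal, in the only form used here.  With x the
    generators of the presentation, x = T y and y = S x, the determinant of Y
    is that of the relations (Y, 0), (-T, 1) between y and x; adding the
    y-columns times S to the x-columns turns the latter into relations between
    the x alone, which factor through A. *)
Lemma divides_det_relations r s m (A : 'M[R]_(r, s)) (M : lmodType R) E
    (y : 'I_m -> M) (Y : 'M[R]_m) :
  presents A M ->
  (forall W : 'M[R]_(s, r), divides E (\det (W *m A))) ->
  (forall x, exists a : 'I_m -> R, x = \sum_k a k *: y k) ->
  (forall i, \sum_k Y i k *: y k = 0) ->
  divides E (\det Y).
Proof.
move=> [h [h_surj h_ker]] EA y_gen Yy.
have /choice[a ha] j := y_gen (h (delta_mx 0 j)).
have /choice[b hb] k := h_surj (y k).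
pose T : 'M[R]_(s, m) := \matrix_(j, k) a j k.
pose S : 'M[R]_(m, s) := \matrix_(k, j) b k 0 j.
have hlin n (w : 'rV[R]_n) (B : 'M_(n, s)) : h (w *m B) = \sum_k w 0 k *: h (row k B).
  rewrite mulmx_sum_row linear_sum; apply: eq_bigr => k _; exact: linearZ.
have rowS k : row k S = b k by apply/rowP=> j; rewrite !mxE.
have hT w : \sum_k (w *m T) 0 k *: y k = h w.
  rewrite -[w in RHS]mulmx1 hlin.
  under [RHS]eq_bigr => j _ do rewrite row1 ha scaler_sumr.
  rewrite exchange_big; apply: eq_bigr => k _ /=.
  rewrite mxE scaler_suml; apply: eq_bigr => j _.
  by rewrite mxE scalerA.
have relA n (V : 'M[R]_(n, s)) : (forall i, h (row i V) = 0) -> exists W, V = W *m A.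
  move=> V0; have /choice[w hw] i := (h_ker (row i V)).1 (V0 i).
  exists (\matrix_i w i); apply/row_matrixP => i.
  by rewrite row_mul rowK -hw.
pose Z : 'M[R]_(m + s) := block_mx Y 0 (- T) 1%:M.
have detZ : \det Z = \det Y by rewrite det_lblock det1 mulr1.
pose K : 'M[R]_(m + s) := block_mx 1%:M S 0 1%:M.
have detK : \det K = 1 by rewrite det_ublock !det1 mulr1.
rewrite -detZ -[\det Z]mulr1 -detK -det_mulmx.
have [W hW] : exists W, col_mx (Y *m S) (1%:M - T *m S) = W *m A.
  apply: relA => i; case: (split_ordP i) => j ->.
    rewrite rowKu row_mul hlin; under eq_bigr => k _ do rewrite rowS hb mxE.
    exact: Yy.
  rewrite rowKd linearB /= linearB /= row1 row_mul hlin.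
  under [X in _ - X]eq_bigr => k _ do rewrite rowS hb.
  have -> : row j T = delta_mx 0 j *m T by rewrite rowE.
  by rewrite hT subrr.
have -> : Z *m K = row_mx (col_mx Y (- T)) (W *m A).
  rewrite mulmx_block -hW !mulmx1 !mul0mx !mulmx0 !addr0.
  by rewrite block_mxEh mulNmx (addrC _ 1%:M).
exact: divides_det_row_mx.
Qed.

End Minors.

(** * Lattices and indices *)

Section Span.
Variables (V : zmodType) (n : nat) (e : 'I_n -> V).

Definition int_span (a : 'rV[int]_n) : V := \sum_i e i *~ a 0 i.

Lemma int_span_is_additive : zmod_morphism int_span.
Proof.
move=> a b; rewrite /int_span -sumrB; apply: eq_bigr => i _.
by rewrite !mxE mulrzBr.
Qed.

HB.instance Definition _ :=
  GRing.isZmodMorphism.Build _ _ int_span int_span_is_additive.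

Lemma int_span_delta i : int_span (delta_mx 0 i) = e i.
Proof.
rewrite /int_span (bigD1 i) //= mxE !eqxx mulr1z big1 ?addr0 // => j ji.
by rewrite mxE (negPf ji) andbF mulr0z.
Qed.

End Span.

Lemma additive_rVE (V : zmodType) n (f : {additive 'rV[int]_n -> V}) u :
  f u = int_span (fun i => f (delta_mx 0 i)) u.
Proof.
rewrite [u in LHS]row_sum_delta raddf_sum; apply: eq_bigr => i _.
by rewrite -[u 0 i]intz scaler_int raddfMz intz.
Qed.

Lemma additive_lin1_mx m n (f : {additive 'rV[int]_m -> 'rV[int]_n}) u :
  f u = u *m lin1_mx f.
Proof.
rewrite additive_rVE mulmx_sum_row; apply: eq_bigr => i _.
rewrite -[u 0 i in RHS]intz scaler_int; congr (_ *~ _).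
by apply/rowP=> j; rewrite !mxE.
Qed.

(** If some combination of the generators vanishes, it is a multiple of a
    primitive one, which vanishes too by torsion-freeness and can be completed
    to a basis of Z^n; so one generator can be dropped. *)
Lemma torsion_free_span_free (V : zmodType) n (e : 'I_n -> V) :
  (forall (v : V) (k : int), k != 0 -> v *~ k = 0 -> v = 0) ->
  exists (d : nat) (psi : {additive 'rV[int]_d -> V}),
    [/\ injective psi, forall i, exists u, psi u = e i &
        forall u, exists a, psi u = int_span e a].
Proof.
move=> tf; elim: n e => [|n IHn] e.
  exists 0, (int_span e); split=> [u v _|[]//|u]; last by exists u.
  by rewrite [u]thinmx0 [v]thinmx0.
have [e_inj|] := pselect (injective (int_span e)).
  exists n.+1, (int_span e); split=> // [i|u]; last by exists u.
  by exists (delta_mx 0 i); apply: int_span_delta.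
move=> /existsNP[a1 /existsNP[a2 /not_implyP[/eqP ea12 a12]]].
pose a := a1 - a2.
have a0 : a != 0 by rewrite subr_eq0; apply/eqP.
have ea0 : int_span e a = 0 by apply/eqP; rewrite raddfB subr_eq0.
have [L _ [R uR [s _ aE]]] := int_Smith_normal_form a.
(* Smith normal form of a one-row matrix: a is a multiple of a row of R. *)
have [k ak] : exists k, a = k *: row 0 R.
  exists (L 0 0 * s`_0); rewrite aE; apply/rowP => j.
  rewrite !mxE big_ord_recl big1 ?addr0; last first.
    by move=> i _; rewrite !mxE big_ord1 !mxE mulr0n mulr0 mul0r.
  by rewrite !mxE big_ord1 !mxE mulr1n.
have k0 : k != 0 by apply: contra_neq a0; rewrite ak => ->; rewrite scale0r.
have eR0 : int_span e (row 0 R) = 0.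
  by apply: (tf _ k k0); rewrite -raddfMz -scaler_int intz -ak.
have [d [psi [psi_inj psi_e psi_span]]] :=
  IHn (fun j => int_span e (row (lift 0 j) R)).
have span_R (w : 'rV_n.+1) : exists u, psi u = int_span e (w *m R).
  rewrite mulmx_sum_row raddf_sum big_ord_recl.
  rewrite -[w 0 0]intz scaler_int raddfMz /= eR0 mul0rz add0r.
  have /choice[u hu] := psi_e.
  exists (\sum_j w 0 (lift 0 j) *: u j); rewrite raddf_sum.
  apply: eq_bigr => j _.
  by rewrite -[w _ _]intz !scaler_int !raddfMz hu.
exists d, psi; split=> // [i|u].
  have [u hu] := span_R (delta_mx 0 i *m invmx R).
  by exists u; rewrite hu -mulmxA mulVmx // mulmx1 int_span_delta.
have [b ->] := psi_span u.
exists (\sum_j b 0 j *: row (lift 0 j) R); rewrite raddf_sum.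
by apply: eq_bigr => j _; rewrite -[b _ _ in RHS]intz scaler_int raddfMz.
Qed.

Lemma has_index_card (V : zmodType) (H : V -> Prop) (T : finType) (e : T -> V) :
  (forall v, exists! i, H (v - e i)) -> has_index H #|T|.
Proof.
move=> He; exists (e \o enum_val) => v; have [i [Hi i_uniq]] := He v.
exists (enum_rank i); split=> [|j /i_uniq ->] /=; first by rewrite enum_rankK.
by rewrite enum_valK.
Qed.

(** In Smith normal form the quotient is a product of cyclic groups, whose
    elements are the tuples of remainders. *)
Lemma has_index_det d (F : 'M[int]_d) : \det F != 0 ->
  has_index (fun v : 'rV_d => exists u, v = u *m F) `|\det F|%N.
Proof.
have [L uL [R uR [s _ FE0]]] := int_Smith_normal_form F.
pose c (i : 'I_d) : int := s`_i.
have FE : F = L *m diag_mx (\row_i c i) *m R.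
  by rewrite FE0; congr (_ *m _ *m _); apply/matrixP => i j; rewrite !mxE.
have detF : `|\det F|%N = (\prod_(i < d) `|c i|)%N.
  have unit1 (A : 'M[int]_d) : A \in unitmx -> `|\det A|%N = 1%N.
    by rewrite unitmxE => /orP[]/eqP->.
  rewrite FE !det_mulmx det_diag !abszM !unit1 // muln1 mul1n.
  elim/big_rec2: _ => // i m x _ <-; rewrite mxE abszM.
  by [].
move=> F0; rewrite detF.
have c0 (i : 'I_d) : c i != 0.
  move: F0; rewrite -[\det F == 0]absz_eq0 detF; apply: contra_neq => ci.
  by rewrite (bigD1 i) //= ci.
have imF (v : 'rV[int]_d) :
    (exists u, v = u *m F) <-> forall i, (c i %| (v *m invmx R) ord0 i)%Z.
  split=> [[u ->] i|cv].
    by rewrite FE !mulmxA mulmxK // mul_mx_diag !mxE dvdz_mull.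
  exists (\row_i ((v *m invmx R) ord0 i %/ c i)%Z *m invmx L).
  rewrite FE !mulmxA mulmxKV // -[LHS](mulmxKV uR); congr (_ *m _).
  apply/rowP => i; rewrite mul_mx_diag -[LHS](divzK (cv i)).
  by rewrite [RHS]mxE [in RHS]mxE [(\row_j c j) _ _]mxE.
pose T := {dffun forall i : 'I_d, 'I_`|c i|%N}.
have -> : (\prod_(i < d) `|c i|)%N = #|T|.
  by rewrite card_dep_ffun foldrE big_map big_enum; apply: eq_bigr => i _;
    rewrite card_ord.
apply: (@has_index_card _ _ _ (fun k : T => \row_i (k i : nat)%:Z *m R)) => v.
have wE (k : T) i : ((v - \row_i (k i : nat)%:Z *m R) *m invmx R) ord0 i
    = (v *m invmx R) ord0 i - (k i : nat)%:Z.
  by rewrite mulmxBl mulmxK // !mxE.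
have modE (k : T) : (exists u, v - \row_i (k i : nat)%:Z *m R = u *m F) <->
    forall i, ((v *m invmx R) ord0 i %% c i)%Z = (k i : nat).
  rewrite imF; split=> kv i; move: (kv i); rewrite wE -eqz_mod_dvd.
    by move/eqP->; rewrite -modz_abs modz_small //= ltz_nat ltn_ord.
  by move->; rewrite -modz_abs modz_small //= ltz_nat ltn_ord.
have ltn_mod i : (`|((v *m invmx R) ord0 i %% c i)%Z| < `|c i|)%N.
  by rewrite -ltz_nat gez0_abs ?modz_ge0 // abszE ltz_mod.
exists [ffun i => Ordinal (ltn_mod i)]; split.
  by apply/modE => i; rewrite ffunE /= gez0_abs ?modz_ge0.
move=> k /modE kv; apply/ffunP => i; rewrite ffunE; apply/val_inj => /=.
by rewrite kv.
Qed.

Section PencilDeterminant.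
Variables (R : comNzRingType) (d : nat) (F G : 'M[R]_d).

Definition pencil : 'M[{poly R}]_d := 'X *: map_mx polyC G - map_mx polyC F.

Lemma size_prod_linear n (a b : 'I_n -> R) :
  (size (\prod_i (a i *: 'X + (b i)%:P))%R <= n.+1)%N.
Proof.
elim: n a b => [|n IHn] a b; first by rewrite big_ord0 size_poly1.
rewrite big_ord_recl; apply: leq_trans (size_polyMleq _ _) _.
rewrite -subn1 leq_subLR; apply: (@leq_add _ _ 2 n.+1) => //.
apply: leq_trans (size_polyD _ _) _; rewrite geq_max.
rewrite (leq_trans (size_scale_leq _ _)) ?size_polyX //.
exact: leq_trans (size_polyC_leq1 _) _.
Qed.

Lemma coef_prod_linear n (a b : 'I_n -> R) :
  (\prod_i (a i *: 'X + (b i)%:P))`_n = \prod_i a i.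
Proof.
elim: n a b => [|n IHn] a b; first by rewrite !big_ord0 coef1.
rewrite !big_ord_recl mulrDl -scalerAl coefD coefZ coefXM coefCM IHn /=.
by rewrite [X in _ + _ * X]nth_default ?mulr0 ?addr0 // size_prod_linear.
Qed.

Lemma det_pencilE :
  \det pencil = \sum_(s : {perm 'I_d})
    (-1) ^+ s *: \prod_i (G i (s i) *: 'X + (- F i (s i))%:P).
Proof.
apply: eq_bigr => s _; rewrite -mul_polyC rmorph_sign; congr (_ * _).
by apply: eq_bigr => i _; rewrite !mxE polyCN mulrC mul_polyC.
Qed.

Lemma size_det_pencil : (size (\det pencil) <= d.+1)%N.
Proof.
rewrite det_pencilE; apply: leq_trans (size_sum _ _ _) _.
apply/bigmax_leqP => s _.
by apply: leq_trans (size_scale_leq _ _) (size_prod_linear _ _).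
Qed.

Lemma coef_det_pencil : (\det pencil)`_d = \det G.
Proof.
rewrite det_pencilE coef_sum; apply: eq_bigr => s _.
by rewrite coefZ coef_prod_linear.
Qed.

Lemma coef0_det_pencil : (\det pencil)`_0 = (-1) ^+ d * \det F.
Proof.
rewrite -horner_coef0 -horner_evalE -det_map_mx -detZ; congr (\det _).
apply/matrixP => i j; rewrite !mxE /= horner_evalE.
by rewrite hornerD hornerN hornerC mulrC hornerM hornerX mulr0 sub0r mulN1r.
Qed.

End PencilDeterminant.

Lemma raddf_int_span (V W : zmodType) n (e : 'I_n -> V) (f : {additive V -> W}) a :
  f (int_span e a) = int_span (f \o e) a.
Proof. by rewrite raddf_sum; apply: eq_bigr => i _; rewrite raddfMz. Qed.

Lemma int_span_image (V : zmodType) n d (e : 'I_n -> V)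
    (psi : {additive 'rV[int]_d -> V}) a :
  (forall i, exists u, psi u = e i) -> exists u, psi u = int_span e a.
Proof.
move=> /choice[u hu]; exists (int_span u a).
by rewrite raddf_int_span; apply: eq_bigr => i _; rewrite /= hu.
Qed.

Lemma additive_lift (V : zmodType) m n (phi : {additive 'rV[int]_m -> V})
    (psi : {additive 'rV[int]_n -> V}) :
  injective psi -> (forall u, exists v, psi v = phi u) ->
  exists g : {additive 'rV[int]_m -> 'rV[int]_n}, forall u, psi (g u) = phi u.
Proof.
move=> psi_inj /choice[k hk].
have k_add : zmod_morphism k by move=> u v; apply: psi_inj; rewrite raddfB !hk raddfB.
pose g : {additive 'rV[int]_m -> 'rV[int]_n} :=
  HB.pack k (GRing.isZmodMorphism.Build _ _ k k_add).
by exists g.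
Qed.

(** With fewer columns than rows, the Smith normal form has a zero row. *)
Lemma additive_inj_leq m n (g : {additive 'rV[int]_m -> 'rV[int]_n}) :
  injective g -> (m <= n)%N.
Proof.
move=> g_inj; rewrite leqNgt; apply/negP => lt_nm.
have [L uL [R _ [s _ gE]]] := int_Smith_normal_form (lin1_mx g).
pose i := Ordinal lt_nm.
have : delta_mx 0 i *m invmx L = 0 :> 'rV_m.
  apply: g_inj; rewrite raddf0 additive_lin1_mx gE !mulmxA mulmxKV // -rowE.
  have -> : row i (\matrix_(i, j) (s`_i *+ (i == j :> nat))) = 0 :> 'rV_n.
    by apply/rowP => j; rewrite !mxE eqn_leq leqNgt ltn_ord mulr0n.
  by rewrite mul0mx.
move/(congr1 (mulmx^~ L)); rewrite mulmxKV // mul0mx => /rowP/(_ i).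
by rewrite !mxE !eqxx.
Qed.

(** * Laurent polynomials *)

Lemma laurent_of_poly_is_zmod_morphism : zmod_morphism laurent_of_poly.
Proof. by move=> p q; apply: val_inj; rewrite raddfB /= rmorphB. Qed.

Lemma laurent_of_poly_is_monoid_morphism : monoid_morphism laurent_of_poly.
Proof.
split=> [|p q]; apply: val_inj; first by rewrite rmorph1 /= rmorph1.
by rewrite rmorphM /= rmorphM.
Qed.

HB.instance Definition _ := GRing.isZmodMorphism.Build _ _ laurent_of_poly
  laurent_of_poly_is_zmod_morphism.
HB.instance Definition _ := GRing.isMonoidMorphism.Build _ _ laurent_of_poly
  laurent_of_poly_is_monoid_morphism.

Lemma laurent_of_poly_inj : injective laurent_of_poly.
Proof.
by move=> p q /(congr1 val) /= /eqP; rewrite (@tofrac_eq {poly int}) => /eqP.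
Qed.

Lemma laurent_of_polyC c : laurent_of_poly c%:P = c%:~R.
Proof. by rewrite -[c in LHS]intz !rmorph_int. Qed.

Lemma laurent_of_polyXn n : laurent_of_poly 'X^n = laurent_t ^+ n.
Proof. exact: rmorphXn. Qed.

Lemma laurent_of_polyE n (q : {poly int}) : (size q <= n)%N ->
  laurent_of_poly q = \sum_(i < n) (q`_i)%:~R * laurent_t ^+ i.
Proof.
move=> qn; have -> : q = \sum_(i < n) (q`_i)%:P * 'X^i.
  rewrite -[LHS]coefK poly_def (big_ord_widen n (fun i => q`_i *: 'X^i)) //.
  rewrite big_mkcond; apply: eq_bigr => i _; rewrite mul_polyC.
  by case: ltnP => // ?; rewrite nth_default // scale0r.
rewrite rmorph_sum; apply: eq_bigr => i _.
rewrite rmorphM /= laurent_of_polyC laurent_of_polyXn.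
congr (_%:~R * _); rewrite coef_sum (bigD1 i) //= mul_polyC coefZ coefXn eqxx.
rewrite mulr1 big1 ?addr0 // => j ji.
by rewrite mul_polyC coefZ coefXn eq_sym (negPf (ji : j != i :> nat)) mulr0.
Qed.

Lemma laurent_t_unit : laurent_t \is a GRing.unit.
Proof.
have t0 : val laurent_t != 0 by rewrite /= tofrac_eq0 polyX_eq0.
rewrite unfold_in /= /laurent_unit t0 /=; apply/asboolP; exists 1, 1.
by rewrite expr1 rmorph1 mul1r.
Qed.

Lemma laurent_numerator a : exists n p, a * laurent_t ^+ n = laurent_of_poly p.
Proof.
have [n [p e]] := laurent_predP _ (valP a); exists n, p; apply: val_inj.
by rewrite rmorphM rmorphXn /= -e (rmorphXn (@FracField.tofrac {poly int})).
Qed.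

Lemma laurent_numerator_mx r s (A : 'M[laurent]_(r, s)) :
  exists n (P : 'M[{poly int}]_(r, s)),
    map_mx laurent_of_poly P = laurent_t ^+ n *: A.
Proof.
have /choice[n] (k : 'I_r * 'I_s) := laurent_numerator (A k.1 k.2).
move=> /choice[p np]; pose m := \max_k n k.
exists m, (\matrix_(i, j) (p (i, j) * 'X^(m - n (i, j)))).
apply/matrixP => i j; rewrite !mxE rmorphM /= -np laurent_of_polyXn -mulrA.
rewrite -exprD subnKC; first exact: mulrC.
exact: (leq_bigmax (i, j)).
Qed.

(** Powers of t are units of the Laurent ring, but a polynomial with nonzero
    constant term is prime to t, so divisibility by it descends. *)
Lemma divides_poly (a b : {poly int}) : a`_0 != 0 ->
  divides (laurent_of_poly a) (laurent_of_poly b) -> divides a b.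
Proof.
move=> a0 [c bca]; have [n [p cp]] := laurent_numerator c.
have {bca cp} : b * 'X^n = p * a.
  apply: laurent_of_poly_inj.
  by rewrite !rmorphM /= laurent_of_polyXn bca -cp mulrAC.
elim: n p => [|n IHn] p; first by rewrite mulr1 => ->; exists p.
move=> e; have [q pq] : exists q, p = q * 'X.
  exists (drop_poly 1 p); rewrite -['X]expr1 -[LHS](poly_take_drop 1) -[RHS]add0r.
  congr (_ + _); apply/polyP => -[|i]; rewrite coef_take_poly coef0 //=.
  apply: (mulIf a0); rewrite mul0r -coef0M -e exprSr mulrA coefMX //.
have X0 : 'X != 0 :> {poly int} by rewrite polyX_eq0.
apply: (IHn q); apply: (mulIf X0).
by rewrite -mulrA -exprSr e pq mulrAC.
Qed.

Section LaurentModule.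
Variable N : lmodType laurent.

Lemma laurent_tn_inj n (x y : N) :
  laurent_t ^+ n *: x = laurent_t ^+ n *: y -> x = y.
Proof.
have u : laurent_t ^+ n \is a GRing.unit by rewrite unitrX ?laurent_t_unit.
by move/(congr1 (GRing.scale (laurent_t ^+ n)^-1)); rewrite !scalerA mulVr ?scale1r.
Qed.

(** On an element killed by p only the reduction modulo p of a polynomial
    matters, and only its remainder modulo q: finitely many values.  Hence the
    powers of t repeat on x, so that negative powers act as positive ones. *)
Lemma cyclic_submodule_finite p q (x : N) : prime p -> x *+ p = 0 ->
  map_poly (intr : int -> 'F_p) q != 0 -> laurent_of_poly q *: x = 0 ->
  exists l : seq N, forall a, a *: x \in l.
Proof.
move=> p_pr px q0 qx; pose red := map_poly (intr : int -> 'F_p).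
pose lft (r : {poly 'F_p}) : {poly int} := map_poly (fun a : 'F_p => (a : nat)%:Z) r.
have lftK r : red (lft r) = r.
  apply/polyP => i; rewrite coef_map /= coef_map_id0 //=.
  exact: natr_Zp.
have red0 u : red u = 0 -> laurent_of_poly u *: x = 0.
  move=> u0; have pu i : (p%:Z %| u`_i)%Z.
    rewrite (dvdz_pcharf (pchar_Fp p_pr)).
    by have /eqP := congr1 (fun r : {poly 'F_p} => r`_i) u0; rewrite coef_map coef0.
  rewrite (laurent_of_polyE (leqnn _)) scaler_suml big1 // => i _.
  have -> : (u`_i)%:~R = (u`_i %/ p%:Z)%Z%:~R * p%:R :> laurent.
    by rewrite -[in LHS](divzK (pu i)) rmorphM.
  by rewrite mulrAC -scalerA scaler_nat px scaler0.
have red_eq u v : red u = red v -> laurent_of_poly u *: x = laurent_of_poly v *: x.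
  move=> uv; apply/eqP; rewrite -subr_eq0 -scalerBl -rmorphB; apply/eqP/red0.
  by rewrite /red rmorphB /= -!/(red _) uv subrr.
pose k := size (red q).
pose act (r : {poly_k 'F_p}) := laurent_of_poly (lft r) *: x.
pose rem u := npolyp k (red u %% red q).
have actE u : laurent_of_poly u *: x = act (rem u).
  rewrite /act /rem npolypK; last by rewrite ltnW // ltn_modp.
  rewrite -[RHS]addr0 -[X in _ + X](scaler0 _ (laurent_of_poly (lft (red u %/ red q)))).
  rewrite -qx scalerA -rmorphM -scalerDl -rmorphD; apply: red_eq.
  by rewrite /red rmorphD rmorphM /= -!/(red _) !lftK addrC -divp_eq.
have [e te] : exists e, laurent_t ^+ e.+1 *: x = x.
  pose f (i : 'I_(#|{poly_k 'F_p}|.+1)) := rem 'X^i.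
  have /injectivePn[i [j ij fij]] : ~~ injectiveb f.
    apply/negP => /injectiveP/leq_card; rewrite card_ord ltnn //.
  wlog lij : i j ij fij / (i < j)%N.
    move=> H; case: (ltngtP i j) => h; first exact: (H i j).
      by apply: (H j i) => //; rewrite eq_sym.
    by case/eqP: ij; apply: val_inj.
  exists (j - i.+1)%N; apply: (@laurent_tn_inj i).
  rewrite scalerA -exprD addnS -addSn subnKC // -!laurent_of_polyXn !actE.
  by rewrite -/(f j) -fij.
exists [seq act r | r : {poly_k 'F_p}] => a.
have [n [u au]] := laurent_numerator a.
suff -> : a *: x = laurent_of_poly (u * 'X^(e * n)) *: x.
  by rewrite actE; apply/mapP; exists (rem (u * 'X^(e * n))); rewrite ?mem_enum.
have ten : laurent_t ^+ (e.+1 * n) *: x = x.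
  elim: n {au} => [|n IHn]; first by rewrite muln0 scale1r.
  by rewrite mulnS exprD -scalerA IHn.
rewrite rmorphM /= laurent_of_polyXn -au -mulrA -exprD -scalerA.
by rewrite -mulSn ten.
Qed.

End LaurentModule.

(** * Finite submodules and presentations *)

Lemma eq_up_to_unit_divides a b : eq_up_to_unit a b -> divides a b /\ divides b a.
Proof.
move=> [s [i ->]]; split; last by exists ((-1) ^+ s * laurent_t ^ i).
exists ((-1) ^+ s * laurent_t ^ (- i)).
rewrite !mulrA [_ * (-1) ^+ s]mulrAC -signr_addb addbb mul1r.
by rewrite -exprzDr ?laurent_t_unit // addNr mul1r.
Qed.

(** The adjugate matrix writes m times each generator as a combination of
    relations. *)
Lemma minor_annihilates (R : comNzRingType) r s (A : 'M[R]_(r, s)) (M : lmodType R)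
    m (x : M) : presents A M -> is_minor A m -> m *: x = 0.
Proof.
move=> [h [h_surj h_ker]] [k [_ ->]]; have [u <-] := h_surj x.
rewrite -linearZ; apply/h_ker; exists (u *m \adj (rowsub k A) *m rowsub k 1%:M).
rewrite -[X in _ = _ *m X]mul1mx.
by rewrite -mulmxA mul_rowsub_mx !mul1mx -mulmxA mul_adj_mx mul_mx_scalar.
Qed.

(** Otherwise p would divide every minor, hence D, hence c. *)
Lemma annihilator_mod_prime (M : lmodType laurent) r s (A : 'M[laurent]_(r, s)) D
    (c : {poly int}) p :
  presents A M -> is_gcd (is_minor A) D -> eq_up_to_unit D (laurent_of_poly c) ->
  prime p -> map_poly (intr : int -> 'F_p) c != 0 ->
  exists q : {poly int}, map_poly (intr : int -> 'F_p) q != 0 /\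
    forall x : M, laurent_of_poly q *: x = 0.
Proof.
move=> MA [_ Dmax] Dc p_pr; apply: contra_neqP => no_q.
have pdvd (q : {poly int}) : map_poly (intr : int -> 'F_p) q = 0 ->
    exists b, q = b * p%:R.
  move=> q0; exists (map_poly (divz^~ p%:Z) q); apply/polyP => i.
  rewrite -(rmorph_nat polyC) mulrC coefCM coef_map_id0 ?div0z // mulrC.
  have pqi : (p%:Z %| q`_i)%Z.
    rewrite (dvdz_pcharf (pchar_Fp p_pr)).
    by have /eqP := congr1 (fun r : {poly 'F_p} => r`_i) q0; rewrite coef_map coef0.
  by rewrite natz divzK.
have : divides p%:R D.
  apply: Dmax => m Am; have [n [q mq]] := laurent_numerator m.
  have [|q0] := eqVneq (map_poly (intr : int -> 'F_p) q) 0; last first.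
    exfalso; apply: no_q; exists q; split=> // x.
    by rewrite -mq mulrC -scalerA (minor_annihilates _ MA Am) scaler0.
  move/pdvd=> [b qb]; exists (laurent_of_poly b / laurent_t ^+ n).
  have u : laurent_t ^+ n \is a GRing.unit by rewrite unitrX ?laurent_t_unit.
  apply: (mulIr u); rewrite mq qb rmorphM rmorph_nat [RHS]mulrAC.
  by congr (_ * _); rewrite mulrVK.
have [[w cw] _] := eq_up_to_unit_divides Dc => -[e De].
have [n [b wb]] := laurent_numerator (w * e).
have cb : c * 'X^n = b * p%:R.
  apply: laurent_of_poly_inj; rewrite !rmorphM rmorph_nat /= laurent_of_polyXn.
  by rewrite cw De -wb mulrA mulrAC.
have := congr1 (map_poly (intr : int -> 'F_p)) cb.
rewrite !rmorphM rmorph_nat /= map_polyXn -(rmorph_nat polyC) (pcharf0 (pchar_Fp p_pr)).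
by rewrite mulr0 => /eqP; rewrite mulf_eq0 expf_eq0 polyX_eq0 andbF orbF => /eqP.
Qed.

(** An element of prime order in the quotient spans a finite submodule, whose
    preimage is again finite, so is contained in N. *)
Lemma quot_torsion_free (M : lmodType laurent) (N : submodClosed M) :
  maximal_finite_submodule N ->
  (forall p, prime p -> exists q : {poly int},
     map_poly (intr : int -> 'F_p) q != 0 /\
     forall x : M, laurent_of_poly q *: x = 0) ->
  forall (x : quot_module N) (k : int), k != 0 -> x *~ k = 0 -> x = 0.
Proof.
move=> [[lN hN] Nmax] ann.
have p_torsion p (x : quot_module N) : prime p -> x *+ p = 0 -> x = 0.
  move=> p_pr px; have [q [q0 qM]] := ann p p_pr.
  have qx : laurent_of_poly q *: x = 0.
    by have [y ->] := quot_pi_surj x; rewrite -linearZ qM linear0.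
  have [l hl] := cyclic_submodule_finite p_pr px q0 qx.
  pose K : {pred M} := fun y => `[< exists a, quot_pi N y = a *: x >].
  have K_submod : submod_closed K.
    split=> [|b y z /asboolP[a ya] /asboolP[a' za]]; apply/asboolP.
      by exists 0; rewrite linear0 scale0r.
    by exists (b * a + a'); rewrite linearP /= ya za scalerDl scalerA.
  pose K' : submodClosed M := HB.pack K (GRing.isSubmodClosed.Build laurent M K K_submod).
  have [y xy] := quot_pi_surj x.
  rewrite xy -[0](linear0 (quot_pi N)); apply/quot_piP.
  rewrite subr0; apply: (Nmax K'); last by apply/asboolP; exists 1; rewrite scale1r.
  exists [seq repr b + n | b <- l, n <- lN] => z /asboolP[a za].
  have -> : z = repr (quot_pi N z) + (z - repr (quot_pi N z)) by rewrite addrC subrK.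
  apply: allpairs_f; first by rewrite za hl.
  by apply: hN; apply/quot_piP; rewrite /quot_pi reprK.
have n_torsion n (x : quot_module N) : (0 < n)%N -> x *+ n = 0 -> x = 0.
  elim/ltn_ind: n x => n IHn x n0 nx.
  have [n1|n1] := leqP n 1.
    by move: nx; have -> : n = 1%N by apply/eqP; rewrite eqn_leq n1.
  have p_pr := pdiv_prime n1; have pn := pdiv_dvd n.
  apply: (IHn (n %/ pdiv n)%N); first by rewrite ltn_Pdiv ?prime_gt1.
    by rewrite divn_gt0 ?pdiv_leq ?pdiv_gt0.
  by apply: (p_torsion _ _ p_pr); rewrite -mulrnA divnK.
move=> x k k0 xk; apply: (n_torsion `|k|%N); first by rewrite absz_gt0.
case: k xk {k0} => n //=.
by rewrite NegzE mulrNz => /eqP; rewrite oppr_eq0 => /eqP.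
Qed.

(** The elements of N, being finitely many, can all be added as relations. *)
Lemma presents_quot_finite (R : comPzRingType) (M : lmodType R) (N : submodClosed M)
    r s (A : 'M[R]_(r, s)) :
  presents A M -> finite_submodule N ->
  exists r' (A' : 'M[R]_(r', s)), presents A' (quot_module N).
Proof.
move=> [h [h_surj h_ker]] [l hl].
have /choice[lft hlft] (x : M) : exists u, x \in N -> h u = x.
  by have [u ux] := h_surj x; exists u.
pose Q : 'M[R]_(size l, s) := \matrix_i (if l`_i \in N then lft l`_i else 0).
exists (r + size l)%N, (col_mx A Q), (quot_pi N \o h); split.
  by move=> x; have [y ->] := quot_pi_surj x; have [u <-] := h_surj y; exists u.
have in_N u : (quot_pi N \o h) u = 0 <-> h u \in N.
  by rewrite /= -[0](linear0 (quot_pi N)) quot_piP subr0.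
move=> u; rewrite in_N; split=> [huN|[v ->]]; last first.
  rewrite -[v]hsubmxK mul_row_col raddfD /=.
  have -> : h (lsubmx v *m A) = 0 by apply/h_ker; exists (lsubmx v).
  rewrite add0r mulmx_sum_row linear_sum; apply: rpred_sum => i _.
  rewrite linearZ /=; apply: rpredZ; rewrite rowK.
  by case: ifP => [lN|_]; rewrite ?hlft // linear0 rpred0.
have lu := hl _ huN.
pose i := Ordinal (etrans (index_mem (h u) l) lu).
have li : l`_i = h u by rewrite nth_index.
have hQ : h (row i Q) = h u by rewrite rowK li huN hlft.
have /h_ker[v vA] : h (u - row i Q) = 0 by rewrite raddfB /= hQ subrr.
exists (row_mx v (delta_mx 0 i)).
by rewrite mul_row_col -rowE -vA subrK.
Qed.

Lemma presents_iso (R : comPzRingType) (M M' : lmodType R) r s (A : 'M[R]_(r, s)) :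
  presents A M -> presents A M' -> lmod_iso M M'.
Proof.
move=> [h [h_surj h_ker]] [h' [h'_surj h'_ker]].
have ker_eq u : h u = 0 <-> h' u = 0 by rewrite h_ker h'_ker.
have /choice[lft lftK] := h_surj; have /choice[lft' lftK'] := h'_surj.
have kh u : h' (lft (h u)) = h' u.
  by apply/eqP; rewrite -subr_eq0 -raddfB; apply/eqP/ker_eq; rewrite raddfB /= lftK subrr.
have kh' u : h (lft' (h' u)) = h u.
  by apply/eqP; rewrite -subr_eq0 -raddfB; apply/eqP/ker_eq; rewrite raddfB /= lftK' subrr.
pose k x := h' (lft x).
have k_lin : linear k.
  by move=> a x y; rewrite /k -{1}(lftK x) -{1}(lftK y) -linearP kh linearP.
pose K : {linear M -> M'} := HB.pack k (GRing.isLinear.Build R M M' *:%R k k_lin).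
exists K; exists (fun x => h (lft' x)) => x /=; first by rewrite /k kh' lftK.
by rewrite /k kh lftK'.
Qed.

Lemma presents_scale_unit (R : comUnitRingType) (M : lmodType R) r s
    (A : 'M[R]_(r, s)) a :
  a \is a GRing.unit -> presents A M -> presents (a *: A) M.
Proof.
move=> ua [h [h_surj h_ker]]; exists h; split=> // u; rewrite h_ker.
split=> -[v ->]; last by exists (a *: v); rewrite -scalemxAr -scalemxAl.
by exists (a^-1 *: v); rewrite -scalemxAr -scalemxAl scalerA mulrV // scale1r.
Qed.

(** * The amalgam as a cokernel *)

Section Extension.
Variables (d : nat) (N : lmodType laurent) (psi : {additive 'rV[int]_d -> N}).

(** The extension of scalars of an additive map out of Z^d. *)
Definition laurent_ext (u : 'rV[laurent]_d) : N := \sum_i u 0 i *: psi (delta_mx 0 i).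

Lemma laurent_ext_is_linear : linear laurent_ext.
Proof.
move=> a u v; rewrite /laurent_ext scaler_sumr -big_split; apply: eq_bigr => i _ /=.
by rewrite !mxE scalerDl scalerA.
Qed.

HB.instance Definition _ :=
  GRing.isLinear.Build laurent _ N *:%R laurent_ext laurent_ext_is_linear.

Lemma laurent_extE b : laurent_ext (map_mx intr b) = psi b.
Proof.
rewrite [RHS]additive_rVE; apply: eq_bigr => i _.
by rewrite mxE scaler_int.
Qed.

End Extension.

Section Pencil.
Variables (d : nat) (f g : {additive 'rV[int]_d -> 'rV[int]_d}).

Definition pencil_t : 'M[laurent]_d :=
  laurent_t *: map_mx intr (lin1_mx g) - map_mx intr (lin1_mx f).

Lemma mul_pencil_t b :
  map_mx intr b *m pencil_t
    = laurent_t *: map_mx intr (g b) - map_mx intr (f b) :> 'rV[laurent]_d.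
Proof.
by rewrite mulmxBr -scalemxAr -!map_mxM -!additive_lin1_mx.
Qed.

Lemma laurent_ext_pencil (N : lmodType laurent) (psi : {additive 'rV[int]_d -> N}) v :
  (forall b, laurent_t *: psi (g b) = psi (f b)) ->
  laurent_ext psi (v *m pencil_t) = 0.
Proof.
move=> gf; rewrite mulmx_sum_row linear_sum big1 // => i _; rewrite linearZ /=.
rewrite rowE -(map_delta_mx intr) mul_pencil_t linearB linearZ /= !laurent_extE.
by rewrite gf subrr scaler0.
Qed.

Lemma det_pencil_t :
  \det pencil_t = laurent_of_poly (\det (pencil (lin1_mx f) (lin1_mx g))).
Proof.
rewrite -det_map_mx; congr (\det _); apply/matrixP => i j.
by rewrite !mxE rmorphB rmorphM /= !laurent_of_polyC.
Qed.

Definition amalgam_base (b : 'rV[int]_d) : amalgam f g := amalgam_pi f g << b *g 0 >>.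

Lemma amalgam_base_is_additive : zmod_morphism amalgam_base.
Proof. by move=> a b; rewrite /amalgam_base monalgUB raddfB. Qed.

HB.instance Definition _ := GRing.isZmodMorphism.Build _ _ amalgam_base
  amalgam_base_is_additive.

Lemma amalgam_piU j b :
  amalgam_pi f g << b *g j >> = laurent_t ^ j *: amalgam_base b :> amalgam f g.
Proof.
have shift i : laurent_t *: (amalgam_pi f g << b *g i >> : amalgam f g)
    = amalgam_pi f g << b *g i + 1 >>.
  by rewrite aut_module_tE /= amalgam_shift_pi malg_shiftU.
have shiftn i n : laurent_t ^+ n *: (amalgam_pi f g << b *g i >> : amalgam f g)
    = amalgam_pi f g << b *g i + n%:Z >>.
  elim: n i => [|n IHn] i; first by rewrite scale1r addr0.
  by rewrite exprSr -scalerA shift IHn -addrA.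
case: j => n; first by rewrite [RHS]shiftn add0r.
apply: (@laurent_tn_inj (amalgam f g) n.+1).
have u : laurent_t ^+ n.+1 \is a GRing.unit by rewrite unitrX ?laurent_t_unit.
by rewrite shiftn NegzE addNr scalerA mulrV // scale1r.
Qed.

(** Only after passing to the quotient by the rows of [pencil_t] does this map
    factor through the amalgam. *)
Definition amalgam_lift (x : {malg 'rV[int]_d[int]}) : 'rV[laurent]_d :=
  \sum_(j <- msupp x) laurent_t ^ j *: map_mx intr x@_j.

Lemma amalgam_liftE (A : {fset int}) x : (msupp x `<=` A)%fset ->
  amalgam_lift x = \sum_(j <- A) laurent_t ^ j *: map_mx intr x@_j.
Proof.
move=> xA; apply: big_fset_incl => // j _ /mcoeff_outdom ->.
by rewrite map_mx0 scaler0.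
Qed.

Lemma amalgam_lift_is_additive : zmod_morphism amalgam_lift.
Proof.
move=> x y; pose A := (msupp x `|` msupp y)%fset.
rewrite !(@amalgam_liftE A) ?fsubsetUl ?fsubsetUr ?msuppB_le //.
rewrite -sumrB; apply: eq_bigr => j _.
by rewrite mcoeffB map_mxB scalerBr.
Qed.

HB.instance Definition _ := GRing.isZmodMorphism.Build _ _ amalgam_lift
  amalgam_lift_is_additive.

Lemma amalgam_liftU j b : amalgam_lift << b *g j >> = laurent_t ^ j *: map_mx intr b.
Proof.
rewrite (@amalgam_liftE [fset j]%fset) ?msuppU_le // big_seq_fset1.
by rewrite mcoeffUU.
Qed.

Lemma amalgam_liftK x : laurent_ext amalgam_base (amalgam_lift x) = amalgam_pi f g x.
Proof.
rewrite [in RHS](monalgE x) linear_sum raddf_sum; apply: eq_bigr => j _.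
by rewrite linearZ /= laurent_extE amalgam_piU.
Qed.

Lemma amalgam_lift_surj u : exists x, amalgam_lift x = u.
Proof.
have [n [P Pu]] := laurent_numerator_mx u.
pose m := \max_i size (P ord0 i).
exists (\sum_(k < m) << \row_i (P 0 i)`_k *g k%:Z - n%:Z >>).
rewrite raddf_sum; apply: (@laurent_tn_inj _ n); rewrite -Pu scaler_sumr.
apply/rowP => i; rewrite summxE mxE (@laurent_of_polyE m); last exact: leq_bigmax.
apply: eq_bigr => k _ /=; rewrite amalgam_liftU scalerA.
rewrite -[laurent_t ^+ n]/(laurent_t ^ n%:Z) -exprzDr ?laurent_t_unit // addrC subrK.
by rewrite !mxE mulrC.
Qed.

(** Every vector over the Laurent ring is the lift of an element of the direct
    sum, and lifting sends the amalgamation relations to multiples of the rows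
    of the pencil. *)
Lemma amalgam_presented : presents pencil_t (amalgam f g).
Proof.
have gf b : laurent_t *: amalgam_base (g b) = amalgam_base (f b) by exact: amalgam_tE.
exists (laurent_ext amalgam_base); split=> [x|u].
  by have [y ->] := amalgam_pi_surj x; exists (amalgam_lift y); apply: amalgam_liftK.
split=> [|[v ->]]; last exact: laurent_ext_pencil.
have [x <-] := amalgam_lift_surj u; rewrite /= amalgam_liftK -[0](raddf0 (amalgam_pi f g)).
move/amalgam_piP; rewrite subr0 => /asboolP x_rel.
pose K : {pred {malg 'rV[int]_d[int]}} :=
  fun y => `[< exists v : 'rV_d, amalgam_lift y = v *m pencil_t >].
have K_zmod : zmod_closed K.
  split=> [|y z /asboolP[v yv] /asboolP[w zw]]; apply/asboolP.
    by exists 0; rewrite raddf0 mul0mx.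
  by exists (v - w); rewrite raddfB /= yv zw mulmxBl.
pose K' : zmodClosed {malg 'rV[int]_d[int]} :=
  HB.pack K (GRing.isZmodClosed.Build _ K K_zmod).
suff : x \in K' by move/asboolP.
apply: x_rel => _ [b [j ->]]; apply/asboolP.
exists (- (laurent_t ^ j) *: map_mx intr b).
rewrite raddfB /= !amalgam_liftU -scalemxAl mul_pencil_t exprzDr ?laurent_t_unit //.
by rewrite scaleNr scalerBr opprB scalerA.
Qed.

End Pencil.

(** * A pencil presenting a torsion-free module *)

Section Lattice.
Variables (s n : nat).

Definition monomial (k : 'I_#|{: 'I_n * 'I_s}|) : 'rV[laurent]_s :=
  laurent_t ^+ (enum_val k).1 *: delta_mx 0 (enum_val k).2.

Lemma monomial_rank i j :
  monomial (enum_rank (i, j)) = laurent_t ^+ i *: delta_mx 0 j.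
Proof. by rewrite /monomial enum_rankK. Qed.

Lemma int_span_monomial (w : 'rV[{poly int}]_s) :
  (forall j, size (w ord0 j) <= n)%N ->
  exists a, map_mx laurent_of_poly w = int_span monomial a.
Proof.
move=> wn; pose a : 'rV[int]_#|{: 'I_n * 'I_s}| :=
  \row_(k < #|{: 'I_n * 'I_s}|) (w 0 (enum_val k).2)`_((enum_val k).1).
exists a; rewrite /int_span (reindex enum_rank) /=; last first.
  exact/onW_bij/enum_rank_bij.
transitivity (\sum_i \sum_j monomial (enum_rank (i, j)) *~ (w 0 j)`_i); last first.
  by rewrite pair_bigA; apply: eq_bigr => -[i j] _; rewrite mxE enum_rankK.
rewrite exchange_big [LHS]row_sum_delta; apply: eq_bigr => j _ /=.
rewrite mxE (laurent_of_polyE (wn j)) scaler_suml; apply: eq_bigr => i _.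
by rewrite monomial_rank -scaler_int scalerA.
Qed.

End Lattice.

(** The images of [psi] and [psiU] are the spans B and U of the monomials t^i x_j
    with i <= n and with i < n.
    That t g - f presents N is proved inside the amalgam of f and g, through
    the map [h0] of its presentation: the images there of the generators of N
    satisfy the relations of N. *)
Lemma pencil_presentation (N : lmodType laurent) r s (P : 'M[{poly int}]_(r, s))
    (q : {poly int}) :
  (forall (x : N) (k : int), k != 0 -> x *~ k = 0 -> x = 0) ->
  presents (map_mx laurent_of_poly P) N ->
  q != 0 -> (forall x : N, laurent_of_poly q *: x = 0) ->
  exists (d : nat) (f g : {additive 'rV[int]_d -> 'rV[int]_d}),
    [/\ injective f, injective g & presents (pencil_t f g) N].
Proof.
move=> tf [h [h_surj h_ker]] q0 qN.
pose n := maxn (size q) (\max_ij size (P ij.1 ij.2)).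
have tN_inj (x y : N) : laurent_t *: x = laurent_t *: y -> x = y.
  by move=> xy; apply: (@laurent_tn_inj N 1); rewrite expr1.
pose x j := h (delta_mx 0 j).
have monE m k : h (@monomial s m k) = laurent_t ^+ (enum_val k).1 *: x (enum_val k).2.
  exact: linearZ.
have [dU [psiU [psiU_inj mU U_span]]] :=
  torsion_free_span_free (h \o @monomial s n) tf.
have [d [psi [psi_inj mB B_span]]] :=
  torsion_free_span_free (h \o @monomial s n.+1) tf.
have UE i j : (i < n)%N -> exists u, psiU u = laurent_t ^+ i *: x j.
  move=> ilt; have [u hu] := mU (enum_rank (Ordinal ilt, j)).
  by exists u; rewrite hu /= monE enum_rankK.
have BE i j : (i <= n)%N -> exists b, psi b = laurent_t ^+ i *: x j.
  rewrite -ltnS => ilt; have [b hb] := mB (enum_rank (Ordinal ilt, j)).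
  by exists b; rewrite hb /= monE enum_rankK.
have [g psi_g] : exists g : {additive 'rV[int]_dU -> 'rV[int]_d},
    forall u, psi (g u) = psiU u.
  apply: additive_lift => // u; have [a ->] := U_span u.
  apply: int_span_image => k; rewrite /= monE; apply: BE.
  exact/ltnW/ltn_ord.
have [f psi_f] : exists f : {additive 'rV[int]_dU -> 'rV[int]_d},
    forall u, psi (f u) = laurent_t *: psiU u.
  pose tU u := laurent_t *: psiU u.
  have tU_add : zmod_morphism tU by move=> u v; rewrite /tU raddfB scalerBr.
  pose tU' : {additive 'rV[int]_dU -> N} :=
    HB.pack tU (GRing.isZmodMorphism.Build _ _ tU tU_add).
  apply: (@additive_lift _ _ _ tU') => // u /=; rewrite /tU.
  have [a ->] := U_span u; rewrite /int_span scaler_sumr.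
  have -> : \sum_i laurent_t *: ((h \o @monomial s n) i *~ a 0 i)
      = int_span (fun k => laurent_t *: h (@monomial s n k)) a.
    by apply: eq_bigr => i _; rewrite -!scaler_int !scalerA mulrC.
  apply: int_span_image => k; rewrite monE scalerA -exprS; apply: BE.
  exact: ltn_ord.
have g_inj : injective g by move=> u v uv; apply: psiU_inj; rewrite -!psi_g uv.
have f_inj : injective f.
  by move=> u v uv; apply: psiU_inj; apply: tN_inj; rewrite -!psi_f uv.
(* The leading coefficient of q sends t^n x_j into U, and the other generators
   of B are generators of U; so U and B have the same rank. *)
have [e psiU_e] : exists e : {additive 'rV[int]_d -> 'rV[int]_dU},
    forall b, psiU (e b) = psi b *~ lead_coef q.
  pose aB b := psi b *~ lead_coef q.
  have aB_add : zmod_morphism aB by move=> u v; rewrite /aB raddfB mulrzBl.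
  pose aB' : {additive 'rV[int]_d -> N} :=
    HB.pack aB (GRing.isZmodMorphism.Build _ _ aB aB_add).
  apply: (@additive_lift _ _ _ aB') => // b /=; rewrite /aB.
  have [a ->] := B_span b; rewrite [_ *~ _]mulrz_suml.
  have -> : \sum_i (h \o @monomial s n.+1) i *~ a 0 i *~ lead_coef q
      = int_span (fun k => h (@monomial s n.+1 k) *~ lead_coef q) a.
    by apply: eq_bigr => i _; rewrite mulrzAC.
  apply: int_span_image => k; rewrite monE.
  set i := (enum_val k).1; set j := (enum_val k).2.
  have := ltn_ord i; rewrite ltnS leq_eqVlt => /predU1P[->|ilt]; last first.
    have [u hu] := UE i j ilt; exists (u *~ lead_coef q).
    by rewrite raddfMz hu.
  pose k0 := (size q).-1.
  have sq : size q = k0.+1 by rewrite prednK // lt0n size_poly_eq0.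
  have kn : (k0 < n)%N by rewrite -sq leq_maxl.
  have := qN (laurent_t ^+ (n - k0) *: x j).
  rewrite (@laurent_of_polyE k0.+1) ?sq // big_ord_recr /= scalerDl.
  rewrite [X in _ + X]scalerA -mulrA -exprD subnKC ?(ltnW kn) // -[X in _ + X]scalerA.
  rewrite scaler_int.
  rewrite -/(lead_coef q) => /eqP; rewrite addrC addr_eq0 => /eqP ->.
  have /choice[u hu] (l : 'I_k0) : exists u,
      psiU u = ((q`_l)%:~R * laurent_t ^+ l) *: (laurent_t ^+ (n - k0) *: x j).
    have [|u hu] := UE (l + (n - k0))%N j.
      by rewrite -[X in (_ < X)%N](subnKC (ltnW kn)) ltn_add2r.
    exists (u *~ q`_l).
    by rewrite raddfMz hu -scalerA scaler_int scalerA exprD.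
  exists (- \sum_l u l); rewrite raddfN raddf_sum scaler_suml; congr (- _).
  by apply: eq_bigr => l _; rewrite /= hu.
have e_inj : injective e.
  move=> b b' ebb; apply: psi_inj; apply/eqP; rewrite -subr_eq0; apply/eqP.
  apply: (tf _ (lead_coef q)); first by rewrite lead_coef_eq0.
  by rewrite mulrzBl -!psiU_e ebb subrr.
have dUd : dU = d.
  by apply/eqP; rewrite eqn_leq (additive_inj_leq g_inj) (additive_inj_leq e_inj).
move: {mU U_span UE e psiU_e e_inj} psiU psiU_inj UE f g psi_f psi_g f_inj g_inj.
rewrite dUd {dU dUd} => psiU psiU_inj UE f g psi_f psi_g f_inj g_inj.
exists d, f, g; split=> //.
have gf b : laurent_t *: psi (g b) = psi (f b) by rewrite psi_g psi_f.
have /choice[b hb] j : exists b, psi b = x j.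
  by have [b hb] := BE 0 j isT; exists b; rewrite hb scale1r.
pose Bm : 'M[laurent]_(s, d) := \matrix_j map_mx intr (b j).
have extBm v : laurent_ext psi (v *m Bm) = h v.
  rewrite mulmx_sum_row linear_sum [v in RHS]row_sum_delta linear_sum.
  by apply: eq_bigr => j _; rewrite !linearZ /= rowK laurent_extE hb.
have [h0 [_ h0_ker]] := amalgam_presented f g.
have h0_gf c : laurent_t *: h0 (map_mx intr (g c)) = h0 (map_mx intr (f c)).
  apply/eqP; rewrite -subr_eq0 -linearZ -linearB /= -mul_pencil_t; apply/eqP/h0_ker.
  by exists (map_mx intr c).
exists (laurent_ext psi); split=> [y|u].
  by have [v <-] := h_surj y; exists (v *m Bm); apply: extBm.
split=> [|[v ->]]; last exact: laurent_ext_pencil.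
(* For i <= n the element t^i x_j of B, seen in degree 0 of the amalgam, is
   t^i times x_j: each factor t is moved across by one amalgamation. *)
have h0_t i j c : (i <= n)%N -> psi c = laurent_t ^+ i *: x j ->
    h0 (map_mx intr c) = laurent_t ^+ i *: h0 (map_mx intr (b j)).
  elim: i c => [|i IHi] c i_n cE.
    by rewrite scale1r; congr (h0 (map_mx _ _)); apply: psi_inj; rewrite cE scale1r hb.
  have [z hz] := UE i j i_n.
  have -> : c = f z by apply: psi_inj; rewrite psi_f hz cE scalerA exprS.
  rewrite -h0_gf exprS -scalerA; congr (_ *: _); apply: IHi; first exact: ltnW.
  by rewrite psi_g.
have h0_span (a : 'rV[int]_#|{: 'I_n.+1 * 'I_s}|) c :
    psi c = h (int_span (@monomial s n.+1) a) ->
    h0 (map_mx intr c) = h0 (int_span (@monomial s n.+1) a *m Bm).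
  have /choice[w hw] := mB.
  have -> : h (int_span (@monomial s n.+1) a) = psi (int_span w a).
    by rewrite !raddf_int_span; apply: eq_bigr => k _; rewrite /= hw.
  move/psi_inj->; rewrite -[LHS]/((h0 \o map_mx intr) (int_span w a)).
  rewrite -[RHS]/((h0 \o mulmxr Bm) (int_span _ a)) !raddf_int_span.
  apply: eq_bigr => k _; congr (_ *~ _).
  rewrite /= /monomial -scalemxAl -rowE rowK linearZ; apply: h0_t.
    by rewrite -ltnS; apply: ltn_ord.
  by rewrite hw /= monE.
(* The rows of P have degree at most n, so they are evaluated inside B. *)
have h0_rel v : h v = 0 -> h0 (v *m Bm) = 0.
  move=> /h_ker[w ->]; rewrite -mulmxA mulmx_sum_row linear_sum big1 // => i _.
  rewrite linearZ /= row_mul -map_row.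
  have [j|a wa] := @int_span_monomial s n.+1 (row i P).
    rewrite mxE leqW // (leq_trans _ (leq_maxr _ _)) //.
    exact: (leq_bigmax (i, j)).
  have : h (map_mx laurent_of_poly (row i P)) = 0.
    by apply/h_ker; exists (delta_mx 0 i); rewrite -rowE map_row.
  rewrite wa => ha; rewrite -(h0_span _ 0) ?map_mx0 ?linear0 ?scaler0 //.
  by rewrite raddf0 ha.
have /choice[a ha] i := B_span (delta_mx 0 i).
pose T : 'M[laurent]_(d, s) := \matrix_i int_span (@monomial s n.+1) (a i).
(* Both maps out of the free module on B factor through the free module on the
   x_j, by the same matrix T. *)
have extT : laurent_ext psi u = h (u *m T).
  rewrite mulmx_sum_row linear_sum; apply: eq_bigr => i _.
  by rewrite linearZ /= rowK ha; congr (_ *: _); rewrite raddf_int_span.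
have h0T : h0 u = h0 (u *m T *m Bm).
  rewrite -mulmxA mulmx_sum_row [u in LHS]row_sum_delta !linear_sum.
  apply: eq_bigr => i _; rewrite !linearZ /= row_mul rowK.
  rewrite -(h0_span _ (delta_mx 0 i)); first by rewrite map_delta_mx.
  by rewrite ha raddf_int_span.
by rewrite /= extT => /h0_rel; rewrite -h0T => /h0_ker.
Qed.

(** * The order and the determinant of the pencil *)

Lemma additive_inj_det d (f : {additive 'rV[int]_d -> 'rV[int]_d}) :
  injective f -> \det (lin1_mx f) != 0.
Proof.
move=> f_inj; apply/negP => /det0P[v v0 vf]; case/eqP: v0.
by apply: f_inj; rewrite raddf0 additive_lin1_mx.
Qed.

Lemma divides_order_rect r s (A : 'M[laurent]_(r, s)) D (W : 'M[laurent]_(s, r)) :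
  is_gcd (is_minor A) D -> divides D (\det (W *m A)).
Proof.
move=> [D_minor _]; rewrite det_mulmx_rect; apply: divides_sum => f _.
exact/divides_mull/rowsub_minor.
Qed.

Section Comparison.
Variables (M : lmodType laurent) (N : submodClosed M).
Variables (r s d : nat) (A : 'M[laurent]_(r, s)) (C : 'M[laurent]_d) (D : laurent).
Hypothesis MA : presents A M.
Hypothesis NC : presents C (quot_module N).
Hypothesis AD : is_gcd (is_minor A) D.

(** A minor of A is the determinant of relations between the generators of M,
    which also generate the quotient. *)
Lemma det_divides_order : divides (\det C) D.
Proof.
have [h [h_surj h_ker]] := MA.
apply: AD.2 => _ [k [_ ->]].
have extE (w : 'rV_s) :
    \sum_j w 0 j *: quot_pi N (h (delta_mx 0 j)) = quot_pi N (h w).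
  rewrite [w in RHS]row_sum_delta !linear_sum; apply: eq_bigr => j _.
  by rewrite !linearZ.
apply: (divides_det_relations (y := fun j => quot_pi N (h (delta_mx 0 j))) NC).
- by move=> W; rewrite det_mulmx; exists (\det W).
- move=> x; have [y ->] := quot_pi_surj x; have [u <-] := h_surj y.
  by exists (u 0); rewrite extE.
- move=> i.
  have rowkA j : rowsub k A i j = row i (rowsub k A) 0 j by rewrite [RHS]mxE.
  under eq_bigr => j _ do rewrite rowkA.
  rewrite extE.
  have -> : h (row i (rowsub k A)) = 0.
    by apply/h_ker; exists (delta_mx 0 (k i)); rewrite -rowE; apply/rowP => j; rewrite !mxE.
  by rewrite linear0.
Qed.

Lemma finite_submodule_exponent : finite_submodule N ->
  exists n, (0 < n)%N /\ forall z, z \in N -> z *+ n = 0.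
Proof.
move=> [l hl].
have exp1 z : z \in N -> exists n, (0 < n)%N /\ z *+ n = 0.
  move=> Nz; pose F (i : 'I_(size l).+1) := index (z *+ i) l.
  have Flt i : (F i < size l)%N by rewrite index_mem hl // rpredMn.
  pose F' i := Ordinal (Flt i).
  have /injectivePn[i [j ij Fij]] : ~~ injectiveb F'.
    by apply/negP => /injectiveP/leq_card; rewrite !card_ord ltnn.
  have zij : z *+ i = z *+ j.
    rewrite -(nth_index 0 (hl _ (rpredMn i Nz))) -(nth_index 0 (hl _ (rpredMn j Nz))).
    by congr (nth _ _ _); have /(congr1 val) := Fij.
  wlog lij : i j ij zij {Fij} / (i < j)%N.
    move=> H; case: (ltngtP i j) => h; first exact: (H i j).
      by apply: (H j i) => //; rewrite eq_sym.
    by case/eqP: ij; apply: val_inj.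
  by exists (j - i)%N; rewrite subn_gt0 mulrnBr ?(ltnW lij) // zij subrr.
have /choice[e he] z : exists n, (0 < n)%N /\ (z \in N -> z *+ n = 0).
  have [/exp1[n [n0 nz]]|nNz] := boolP (z \in N); first by exists n.
  by exists 1%N.
exists (\prod_(z <- l) e z)%N; split; first by rewrite prodn_gt0 // => z; case: (he z).
move=> z Nz; have zl := hl _ Nz.
rewrite (big_rem z) //= mulrnA.
by rewrite (he z).2 // mul0rn.
Qed.

(** Lift the generators of the quotient to elements y of M.  The relations C y
    and x = P y hold modulo N only, so they hold in M after multiplication by
    an exponent n of N. *)
Lemma order_divides_det : finite_submodule N ->
  exists n, (0 < n)%N /\ divides D (n%:R * \det C).
Proof.
move=> /finite_submodule_exponent[n [n0 nN]].
exists (n ^ (d + s))%N; split; first by rewrite expn_gt0 n0.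
have [h [h_surj h_ker]] := MA; have [hC [hC_surj hC_ker]] := NC.
have /choice[y hy] i : exists y, hC (delta_mx 0 i) = quot_pi N y.
  exact: quot_pi_surj.
pose x j := h (delta_mx 0 j).
have /choice[p hp] j := hC_surj (quot_pi N (x j)).
pose P : 'M[laurent]_(s, d) := \matrix_j p j.
have yE (w : 'rV_d) : quot_pi N (\sum_i w 0 i *: y i) = hC w.
  rewrite [w in RHS]row_sum_delta !linear_sum; apply: eq_bigr => i _.
  by rewrite !linearZ /= hy.
have NE z : quot_pi N z = 0 -> z *+ n = 0.
  by rewrite -[0](linear0 (quot_pi N)) => /quot_piP; rewrite subr0; apply: nN.
pose Y : 'M[laurent]_(d + s) := block_mx (n%:R *: C) 0 (- n%:R *: P) (n%:R)%:M.
have -> : (n ^ (d + s))%:R * \det C = \det Y.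
  by rewrite det_lblock det_scalar detZ natrX exprD mulrAC.
pose z k := match split k with inl i => y i | inr j => x j end.
apply: (divides_det_relations (y := z) MA) => [W|m|k].
- exact: divides_order_rect.
- have [u <-] := h_surj m.
  exists (fun k => match split k with inl _ => 0 | inr j => u 0 j end).
  rewrite big_split_ord /= big1 ?add0r => [|i _]; last first.
    by rewrite -[lshift _ _]/(unsplit (inl i)) unsplitK scale0r.
  rewrite [u in LHS]row_sum_delta linear_sum; apply: eq_bigr => j _.
  by rewrite linearZ /z -[rshift _ _]/(unsplit (inr j)) unsplitK.
have zl i : z (lshift s i) = y i by rewrite /z -[lshift _ _]/(unsplit (inl i)) unsplitK.
have zr j : z (rshift d j) = x j by rewrite /z -[rshift _ _]/(unsplit (inr j)) unsplitK.
rewrite big_split_ord /=; case: (split_ordP k) => i ->.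
  rewrite [X in _ + X]big1 ?addr0 => [|j _]; last by rewrite block_mxEur mxE scale0r.
  have yC : quot_pi N (\sum_j row i C 0 j *: y j) = 0.
    by rewrite yE; apply/hC_ker; exists (delta_mx 0 i); rewrite rowE.
  transitivity (n%:R *: \sum_j row i C 0 j *: y j : M); last by rewrite scaler_nat NE.
  rewrite scaler_sumr; apply: eq_bigr => j _.
  by rewrite block_mxEul zl !mxE scalerA.
have xP : quot_pi N (x i - \sum_j row i P 0 j *: y j) = 0.
  by rewrite linearB /= yE rowK hp subrr.
transitivity (n%:R *: (x i - \sum_j row i P 0 j *: y j) : M); last by rewrite scaler_nat NE.
rewrite scalerBr [RHS]addrC; congr (_ + _).
  rewrite scaler_sumr -sumrN; apply: eq_bigr => j _.
  by rewrite block_mxEdl zl !mxE scalerA mulNr scaleNr.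
rewrite (bigD1 i) //= block_mxEdr zr mxE eqxx mulr1n big1 ?addr0 // => j ji.
by rewrite block_mxEdr mxE eq_sym (negPf ji) mulr0n scale0r.
Qed.

End Comparison.

(** Divisibility both ways up to integers forces equal degrees; the constant
    quotient divides the content of b. *)
Lemma primitive_quotient (a b : {poly int}) n :
  a`_0 != 0 -> b`_0 != 0 -> (0 < n)%N ->
  (forall e : int, (forall i, (e %| b`_i)%Z) -> (e %| 1)%Z) ->
  divides (laurent_of_poly a) (laurent_of_poly b) ->
  divides (laurent_of_poly b) (n%:R * laurent_of_poly a) ->
  exists e : bool, b = (-1) ^+ e * a.
Proof.
move=> a0 b0 n0 b_prim /(divides_poly a0)[q bqa].
rewrite -(rmorph_nat laurent_of_poly) -rmorphM => /(divides_poly b0)[w abw].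
have az : a != 0 by apply: contra_neq a0 => ->; rewrite coef0.
have bz : b != 0 by apply: contra_neq b0 => ->; rewrite coef0.
have qz : q != 0 by apply: contra_neq bz => q0; rewrite bqa q0 mul0r.
have nz : n%:R != 0 :> {poly int}.
  by rewrite -(rmorph_nat polyC) polyC_eq0 Num.Theory.pnatr_eq0 -lt0n.
have wz : w != 0.
  apply: contra_neq (mulf_neq0 nz az) => w0; by rewrite abw w0 mul0r.
have size_n : size (n%:R : {poly int}) = 1%N.
  by rewrite -(rmorph_nat polyC) size_polyC Num.Theory.pnatr_eq0 -lt0n n0.
have : size q = 1%N.
  have := congr1 (fun u : {poly int} => size u) abw.
  rewrite bqa !size_mul ?mulf_neq0 // size_n.
  rewrite -!size_poly_gt0 in az qz wz; move: (size a) (size q) (size w) az qz wz.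
  move=> [|k] [|l] [|m] //= _ _ _.
  rewrite !addnS /= => -[] /eqP; rewrite addnA -[X in X == _]add0n.
  by rewrite eqn_add2r eq_sym addn_eq0 => /andP[_ /eqP->].
move=> sq; have qC := size1_polyC (eq_leq sq); rewrite qC in bqa.
have : (q`_0 %| 1)%Z.
  by apply: b_prim => i; rewrite bqa coefCM dvdz_mulr.
rewrite dvdz1 bqa => /eqP; case: (q`_0) => -[|[|k]] //= _.
  by exists false.
by exists true; rewrite NegzE polyCN.
Qed.

Theorem corollary2p5 (M : lmodType laurent) (D : laurent)
    (d : nat) (c : 'I_d.+1 -> int) (zM : submodClosed M) :
  finitely_generated M ->
  is_order M D ->
  eq_up_to_unit D (\sum_(i < d.+1) (c i)%:~R * laurent_t ^+ i) ->
  c ord0 * c ord_max != 0 ->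
  \big[gcdz/0]_(i < d.+1) c i = 1 ->
  maximal_finite_submodule zM ->
  exists f g : {additive 'rV[int]_d -> 'rV[int]_d},
    [/\ injective f /\ injective g,
        lmod_iso (quot_module zM) (amalgam f g),
        eq_up_to_unit D
          (\det (laurent_t *: map_mx intr (lin1_mx g) - map_mx intr (lin1_mx f))) &
        has_index (fun v => exists u, v = f u) `|c ord0|%N /\
        has_index (fun v => exists u, v = g u) `|c ord_max|%N].
Proof.
move=> _ [r [s [A [_ MA AD]]]] Dc c0 c_prim zM_max.
have zM_fin := zM_max.1.
pose b : {poly int} := \poly_(i < d.+1) c (inord i).
have bE (i : 'I_d.+1) : b`_i = c i by rewrite coef_poly ltn_ord inord_val.
have Db : eq_up_to_unit D (laurent_of_poly b).
  rewrite (@laurent_of_polyE d.+1) ?size_poly //.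
  by under eq_bigr => i _ do rewrite bE.
have b_prim (e : int) : (forall i, (e %| b`_i)%Z) -> (e %| 1)%Z.
  move=> eb; suff : (e %| \big[gcdz/0%R]_(i < d.+1) c i)%Z by rewrite c_prim.
  apply: (big_ind (fun z => (e %| z)%Z)).
  - exact: dvdz0.
  - by move=> u v eu ev; rewrite dvdz_gcd eu ev.
  - by move=> i _; rewrite -bE.
move: c0; rewrite mulf_eq0 negb_or => /andP[c0 cd].
have b0 : b`_0 != 0 by rewrite (bE ord0).
have size_b : size b = d.+1.
  apply: size_poly_eq; have -> : inord d = ord_max :> 'I_d.+1 by apply: (inord_val ord_max).
  exact: cd.
have ann p : prime p -> exists q : {poly int},
    map_poly (intr : int -> 'F_p) q != 0 /\
    forall x : M, laurent_of_poly q *: x = 0.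
  move=> p_pr; apply: (annihilator_mod_prime MA AD Db p_pr); apply/negP => /eqP bp.
  have : (p%:Z %| 1)%Z.
    apply: b_prim => i; rewrite (dvdz_pcharf (pchar_Fp p_pr)).
    by have /eqP := congr1 (fun q : {poly 'F_p} => q`_i) bp; rewrite coef_map coef0.
  by rewrite dvdzE dvdn1; case: (p) p_pr => [|[]].
have tf := quot_torsion_free zM_max ann.
have [r' [A' A'_pres]] := presents_quot_finite MA zM_fin.
have [m [P PE]] := laurent_numerator_mx A'.
have P_pres : presents (map_mx laurent_of_poly P) (quot_module zM).
  by rewrite PE; apply: presents_scale_unit => //; rewrite unitrX ?laurent_t_unit.
(* Any prime would do: all that matters is a nonzero annihilator. *)
have [q [q0 qM]] := ann 2 isT.
have qz : q != 0 by apply: contra_neq q0 => ->; rewrite rmorph0.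
have qN (x : quot_module zM) : laurent_of_poly q *: x = 0.
  by have [y ->] := quot_pi_surj x; rewrite -linearZ qM linear0.
have [d' [f [g [f_inj g_inj C_pres]]]] := pencil_presentation tf P_pres qz qN.
pose a := \det (pencil (lin1_mx f) (lin1_mx g)).
have detC : \det (pencil_t f g) = laurent_of_poly a := det_pencil_t f g.
have detf := additive_inj_det f_inj; have detg := additive_inj_det g_inj.
have a0 : a`_0 != 0.
  by rewrite coef0_det_pencil mulf_neq0 // expf_neq0 // oppr_eq0 oner_eq0.
have size_a : size a = d'.+1.
  apply/eqP; rewrite eqn_leq size_det_pencil ltnNge; apply/negP => sa.
  by move: detg; rewrite -(coef_det_pencil (lin1_mx f)) nth_default ?eqxx.
have [Db1 Db2] := eq_up_to_unit_divides Db.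
have divides_trans (u v w : laurent) : divides u v -> divides v w -> divides u w.
  by move=> [k ->] [k' ->]; exists (k' * k); rewrite mulrA.
have ab : divides (laurent_of_poly a) (laurent_of_poly b).
  by rewrite -detC; apply: (divides_trans _ D) => //; apply: det_divides_order MA C_pres AD.
have [n [n0 ba]] := order_divides_det MA C_pres AD zM_fin.
rewrite detC in ba.
have [e be] := primitive_quotient a0 b0 n0 b_prim ab (divides_trans _ _ _ Db2 ba).
have d'd : d' = d.
  by apply: succn_inj; rewrite -size_a -size_b be mulr_sign; case: (e); rewrite ?size_polyN.
subst d'.
have ab_abs i : `|(b`_i)%R|%N = `|(a`_i)%R|%N.
  by rewrite be -(rmorph_sign polyC) coefCM abszMsign.
exists f, g; split => //.
- exact: presents_iso C_pres (amalgam_presented f g).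
- rewrite -/(pencil_t f g) detC; have [e' [i ->]] := Db.
  exists (e' (+) e), i; rewrite be rmorphM rmorph_sign signr_addb.
  by rewrite !mulrA; congr (_ * _); rewrite mulrAC.
have imE (k : {additive 'rV[int]_d -> 'rV[int]_d}) :
    (fun v => exists u, v = k u) = (fun v => exists u, v = u *m lin1_mx k).
  by apply/funext => v; apply/propext; split=> -[u ->]; exists u; rewrite additive_lin1_mx.
rewrite !imE; split.
  rewrite -(bE ord0) ab_abs coef0_det_pencil abszMsign; exact: has_index_det.
rewrite -(bE ord_max) ab_abs coef_det_pencil; exact: has_index_det.
Qed.
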